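(* Let $S=(-\frac\pi2,\frac\pi2)^2$. There exists $h_{25}^*>0$ such that the twenty-fifth Robin eigenvalue $\lambda_{25,h}(S)$ is given by the pair $(4,3)$ for $h\le h_{25}^*$ and by the pair $(5,1)$ for $h>h_{25}^*$; that is, $\lambda_{25,h}(S)=\pi^{-2}(\alpha_4(h)^2+\alpha_3(h)^2)$ for $0\le h\le h_{25}^*$ and $\lambda_{25,h}(S)=\pi^{-2}(\alpha_5(h)^2+\alpha_1(h)^2)$ for $h_{25}^*<h<+\infty$.
   Context: For $h\in[0,+\infty)$, $\lambda_{k,h}(S)$, $k\ge1$, denotes the $k$-th eigenvalue (in non-decreasing order, counted with multiplicity) of $-\Delta$ on $S$ with Robin boundary condition $\partial_\nu u+hu=0$ on $\partial S$ ($\nu$ the outward unit normal). For a non-negative integer $p$ and $h>0$, $\alpha_p=\alpha_p(h)$ denotes the non-zero solution in $[p\pi,(p+1)\pi)$ of $\frac{2\alpha_p}{h\pi}\cos\alpha_p+\left(1-\frac{\alpha_p^2}{h^2\pi^2}\right)\sin\alpha_p=0$; equivalently, $\alpha_p\tan(\alpha_p/2)=h\pi$ if $p$ is even and $\frac{\alpha_p}{h\pi}=-\tan(\alpha_p/2)$ if $p$ is odd. For $h=0$, $\alpha_p(0)=p\pi$. The Robin eigenvalues of $S$ are exactly the numbers $\pi^{-2}(\alpha_p(h)^2+\alpha_q(h)^2)$, $p,q\in\{0,1,2,\dots\}$; an eigenvalue equal to this number is said to be given by the pair $(p,q)$. *)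

(* Defs.v *)
From Stdlib Require Import Reals List.
From Coquelicot Require Import Coquelicot.
Open Scope R_scope.

Definition square (z : R * R) : Prop :=
  - (PI / 2) < fst z < PI / 2 /\ - (PI / 2) < snd z < PI / 2.

Definition closed_square (z : R * R) : Prop :=
  - (PI / 2) <= fst z <= PI / 2 /\ - (PI / 2) <= snd z <= PI / 2.

(* fx and fy are the partial derivatives of f on the open square. *)
Definition is_gradient (f fx fy : R * R -> R) : Prop :=
  forall z, square z ->
    is_derive (fun t => f (t, snd z)) (fst z) (fx z) /\
    is_derive (fun t => f (fst z, t)) (snd z) (fy z).

(* d_nu u + h u = 0 on the four open sides; the normal is undefined at the
   corners.  On the boundary ux and uy stand for the continuous extensions of
   the partial derivatives of u. *)
Definition robin_condition (h : R) (u ux uy : R * R -> R) : Prop :=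
  forall t, - (PI / 2) < t < PI / 2 ->
    ux (PI / 2, t) + h * u (PI / 2, t) = 0 /\
    - ux (- (PI / 2), t) + h * u (- (PI / 2), t) = 0 /\
    uy (t, PI / 2) + h * u (t, PI / 2) = 0 /\
    - uy (t, - (PI / 2)) + h * u (t, - (PI / 2)) = 0.

(* Classical solutions of - Delta u = mu u with the Robin condition: C^2 in the
   open square and C^1 up to the boundary.  The zero function is included, so
   that this is the eigenspace of mu (null when mu is not an eigenvalue). *)
Definition robin_eigenspace (h mu : R) (u : R * R -> R) : Prop :=
  exists ux uy uxx uxy uyx uyy : R * R -> R,
    is_gradient u ux uy /\ is_gradient ux uxx uxy /\ is_gradient uy uyx uyy /\
    continuous_on closed_square u /\
    continuous_on closed_square ux /\ continuous_on closed_square uy /\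
    continuous_on square uxx /\ continuous_on square uxy /\
    continuous_on square uyx /\ continuous_on square uyy /\
    (forall z, square z -> - (uxx z + uyy z) = mu * u z) /\
    robin_condition h u ux uy.

Definition lin_comb (m : nat) (c : nat -> R) (v : nat -> R * R -> R)
    (z : R * R) : R :=
  fold_right Rplus 0 (map (fun i => c i * v i z) (seq 0 m)).

(* E has a basis of m elements, functions being identified when they agree on
   the square. *)
Definition has_dim (E : (R * R -> R) -> Prop) (m : nat) : Prop :=
  exists v : nat -> R * R -> R,
    (forall i, (i < m)%nat -> E (v i)) /\
    (forall c : nat -> R, (forall z, square z -> lin_comb m c v z = 0) ->
       forall i, (i < m)%nat -> c i = 0) /\
    (forall u, E u -> exists c : nat -> R,
       forall z, square z -> u z = lin_comb m c v z).

(* lam 1 <= lam 2 <= ... lists the Robin eigenvalues with multiplicity: every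
   mu occurs exactly as many times as the dimension of its eigenspace.  The
   value lam 0 is irrelevant. *)
Definition robin_spectrum (h : R) (lam : nat -> R) : Prop :=
  (forall i j, (1 <= i <= j)%nat -> lam i <= lam j) /\
  (forall mu, exists l : list nat,
     NoDup l /\
     (forall k, In k l <-> (1 <= k)%nat /\ lam k = mu) /\
     has_dim (robin_eigenspace h mu) (length l)).

Definition is_kth_robin_eigenvalue (h : R) (k : nat) (l : R) : Prop :=
  exists lam : nat -> R, robin_spectrum h lam /\ lam k = l.

Definition is_alpha (p : nat) (h a : R) : Prop :=
  (h = 0 /\ a = INR p * PI) \/
  (0 < h /\ a <> 0 /\ INR p * PI <= a < (INR p + 1) * PI /\
   2 * a / (h * PI) * cos a + (1 - a ^ 2 / (h ^ 2 * PI ^ 2)) * sin a = 0).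

(* For h >= 0 there is exactly one such number. *)
Definition alpha (p : nat) (h : R) : R := iota (is_alpha p h).

Definition pair_eigenvalue (p q : nat) (h : R) : R :=
  / PI ^ 2 * (alpha p h ^ 2 + alpha q h ^ 2).

(* Main.v *)
Require Import Defs.
From Stdlib Require Import Reals.
From Stdlib Require Import List Lra Lia Ranalysis5 Classical ClassicalEpsilon FinFun.
From Coquelicot Require Import Coquelicot.
Open Scope R_scope.
Set Bullet Behavior "Strict Subproofs".

(** Write H = h pi and alpha_p = p pi + theta_p with 0 <= theta_p < pi.  The
    transcendental equation factors through the half angle theta_p / 2 and
    becomes theta_p = 2 atan (H / alpha_p) ([is_alpha_atan]).  The theorem is the
    conjunction of two independent facts.

    The spectrum is the multiset of the values lambda_p + lambda_q with
    lambda_p = (alpha_p / pi)^2.  The functions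
    phi_p (x) = cos (alpha_p x / pi + p pi / 2) solve the one-dimensional Robin
    problem on (- pi / 2, pi / 2), so the products phi_p (x) phi_q (y) are
    eigenfunctions; what has to be shown is that there are no others.  For an
    eigenfunction u of eigenvalue mu, the coefficient
    c_p (y) = int u (x, y) phi_p (x) dx solves c_p'' = (lambda_p - mu) c_p with the
    Robin condition ([coef_equation]), hence is orthogonal to every phi_q with
    lambda_p + lambda_q <> mu.  After subtraction of the finitely many remaining
    components, every c_p, and then every slice of u, is orthogonal to all modes,
    and both vanish by completeness ([phi_complete]).  Completeness needs no
    compactness: if f is orthogonal to phi_0, ..., phi_K, some nontrivial combination
    of f and of these K + 1 functions vanishes at the K + 1 zeros of the Neumann
    mode of index K + 1, where Wirtinger's inequality bounds its energy below
    by almost (K + 1)^2 times its square norm; the phi_p contribute less than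
    that since alpha_p < (p + 1) pi, so f, if nonzero, has a Rayleigh quotient of
    at least K^2 ([form_lower_bound]), which is impossible for all K at once.

    The order of the low eigenvalues.  For every h the 22 pairs with entries at most 4
    and sum at most 6, together with (5, 0) and (0, 5), have values at most those of
    both (4, 3) and (5, 1), and any other pair has a value at least that of one of them ([lowest24_inside],
    [lowest24_outside]).  So the twenty-fifth eigenvalue is the smaller of the
    values of (4, 3) and (5, 1).  For their difference D one has
    d (alpha_p^2) / dh = 4 pi f (alpha_p^2) with f (A) = A / (A + H^2 + 2 H), which
    is increasing and concave; therefore D' > 0 wherever D >= 0
    ([crossing_derive_pos]), and D, negative for small h and positive for large h,
    changes sign exactly once ([crossing_unique]). *)

(** * The numbers alpha *)

Lemma cos_sin_shift (p : nat) (t : R) :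
  cos (INR p * PI + t) = (-1) ^ p * cos t /\
  sin (INR p * PI + t) = (-1) ^ p * sin t.
Proof.
  induction p as [|p [IHc IHs]].
  - simpl. rewrite Rmult_0_l, Rplus_0_l. lra.
  - rewrite S_INR. replace ((INR p + 1) * PI + t) with ((INR p * PI + t) + PI) by ring.
    rewrite neg_cos, neg_sin, IHc, IHs. simpl. lra.
Qed.

Lemma pow_m1_sqr (p : nat) : (-1) ^ p * (-1) ^ p = 1.
Proof.
  rewrite <- Rpow_mult_distr. replace (-1 * -1) with 1 by ring. apply pow1.
Qed.

(** With t = (a - p pi) / 2 in [0, pi / 2), the equation reads
    (a cos t + H sin t) (H cos t - a sin t) = 0 up to a sign and a positive factor.
    The first factor is positive, so tan t = H / a.  This removes both the trigonometric
    equation and the parity of p from everything that follows. *)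
Lemma is_alpha_atan (p : nat) (h a : R) : 0 < h ->
  is_alpha p h a <->
  (0 < a /\ INR p * PI <= a < (INR p + 1) * PI /\
   a = INR p * PI + 2 * atan (h * PI / a)).
Proof.
  intros Hh. pose proof PI_RGT_0 as Hpi. pose proof (pos_INR p) as Hp.
  set (t := (a - INR p * PI) / 2).
  assert (Ea : a = INR p * PI + 2 * t) by (unfold t; field).
  assert (Hprod : 0 < a ->
     (2 * a / (h * PI) * cos a + (1 - a ^ 2 / (h ^ 2 * PI ^ 2)) * sin a) * (h * PI) ^ 2
     = (-1) ^ p * (2 * ((a * cos t + h * PI * sin t) * (h * PI * cos t - a * sin t)))).
  { intros _. destruct (cos_sin_shift p (2 * t)) as [Ec Es].
    rewrite <- Ea in Ec, Es. rewrite Ec, Es, cos_2a, sin_2a.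
    field. lra. }
  split.
  - intros [[H0 _]|[_ [Hn [Hb Heq]]]]; [lra|].
    assert (Ha : 0 < a) by nra.
    specialize (Hprod Ha). rewrite Heq, Rmult_0_l in Hprod.
    assert (Ht : 0 <= t < PI / 2) by (unfold t; lra).
    assert (Hc : 0 < cos t) by (apply cos_gt_0; lra).
    assert (Hs : 0 <= sin t) by (apply sin_ge_0; lra).
    assert (E : h * PI * cos t - a * sin t = 0).
    { symmetry in Hprod. apply Rmult_integral in Hprod as [E|E].
      - exfalso. pose proof (pow_m1_sqr p) as Hq. rewrite E in Hq. lra.
      - assert (0 < a * cos t + h * PI * sin t).
        { apply Rplus_lt_le_0_compat; [|apply Rmult_le_pos]; nra. }
        apply Rmult_integral in E as [E|E]; [lra|].
        apply Rmult_integral in E as [E|E]; lra. }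
    split; [exact Ha|]. split; [exact Hb|].
    replace (h * PI / a) with (tan t).
    + rewrite atan_tan by lra. exact Ea.
    + unfold tan. apply Rmult_eq_reg_r with (a * cos t); [|nra].
      transitivity (a * sin t); [|transitivity (h * PI * cos t)]; [field|lra|field]; lra.
  - intros [Ha [Hb He]]. right. split; [exact Hh|]. split; [lra|]. split; [exact Hb|].
    specialize (Hprod Ha).
    assert (Et : t = atan (h * PI / a)) by lra.
    assert (Ht : - (PI / 2) < t < PI / 2).
    { rewrite Et. pose proof (atan_bound (h * PI / a)). lra. }
    assert (Hc : 0 < cos t) by (apply cos_gt_0; lra).
    assert (E : h * PI * cos t - a * sin t = 0).
    { assert (T : tan t = h * PI / a) by (rewrite Et; apply tan_atan).
      unfold tan in T.
      assert (sin t = h * PI / a * cos t) by (rewrite <- T; field; lra).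
      rewrite H. field. lra. }
    rewrite E, !Rmult_0_r in Hprod.
    apply Rmult_integral in Hprod as [E'|E']; [exact E'|].
    exfalso. assert (0 < (h * PI) ^ 2) by (apply pow_lt; nra). lra.
Qed.

Lemma is_alpha_exists (p : nat) (h : R) : 0 < h -> exists a, is_alpha p h a.
Proof.
  intros Hh. pose proof PI_RGT_0 as Hpi. pose proof (pos_INR p) as Hp.
  set (F := fun a => a * sin ((a - INR p * PI) / 2) - h * PI * cos ((a - INR p * PI) / 2)).
  assert (F0 : F (INR p * PI) = - (h * PI)).
  { unfold F. replace ((INR p * PI - INR p * PI) / 2) with 0 by field.
    rewrite sin_0, cos_0. ring. }
  assert (F1 : F ((INR p + 1) * PI) = (INR p + 1) * PI).
  { unfold F. replace (((INR p + 1) * PI - INR p * PI) / 2) with (PI / 2) by field.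
    rewrite sin_PI2, cos_PI2. ring. }
  destruct (IVT_gen F (INR p * PI) ((INR p + 1) * PI) 0) as [a [Hab Fa]].
  - intros x. apply continuity_pt_filterlim. apply (ex_derive_continuous F).
    unfold F. auto_derive. trivial.
  - rewrite F0, F1. rewrite Rmin_left, Rmax_right; nra.
  - rewrite Rmin_left, Rmax_right in Hab by nra.
    assert (Hlt : a < (INR p + 1) * PI).
    { destruct (Req_dec a ((INR p + 1) * PI)) as [E|]; [|lra].
      rewrite E, F1 in Fa. nra. }
    assert (Ha : 0 < a).
    { destruct (Req_dec a 0) as [E|]; [|nra].
      assert (INR p * PI = a) by nra. rewrite <- H, F0 in Fa. nra. }
    exists a. apply is_alpha_atan; [exact Hh|]. split; [exact Ha|]. split; [lra|].
    set (t := (a - INR p * PI) / 2) in *.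
    assert (Hc : 0 < cos t) by (apply cos_gt_0; unfold t; lra).
    replace (h * PI / a) with (tan t).
    + rewrite atan_tan by (unfold t; lra). unfold t; field.
    + unfold F in Fa. fold t in Fa. unfold tan.
      apply Rmult_eq_reg_r with (a * cos t); [|nra].
      transitivity (a * sin t); [|transitivity (h * PI * cos t)]; [field|lra|field]; lra.
Qed.

Lemma atan_le (x y : R) : x <= y -> atan x <= atan y.
Proof.
  intros [H| ->]; [left; now apply atan_increasing|lra].
Qed.

(** In a = p pi + 2 atan (H / a) the left-hand side increases with a while
    the right-hand side decreases. *)
Lemma is_alpha_unique (p : nat) (h a b : R) : 0 < h ->
  is_alpha p h a -> is_alpha p h b -> a = b.
Proof.
  intros Hh. rewrite !is_alpha_atan by exact Hh.
  assert (Hpi := PI_RGT_0).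
  enough (G : forall x y, x < y -> 0 < x ->
     x = INR p * PI + 2 * atan (h * PI / x) -> y = INR p * PI + 2 * atan (h * PI / y) -> False).
  { intros [A1 [_ A3]] [B1 [_ B3]].
    destruct (Rtotal_order a b) as [L|[E|L]]; [|exact E|]; exfalso; eauto. }
  intros x y L Hx Ex Ey.
  assert (h * PI / y <= h * PI / x).
  { apply Rmult_le_compat_l; [nra|]. apply Rinv_le_contravar; lra. }
  apply atan_le in H. lra.
Qed.

Lemma alpha_spec (p : nat) (h : R) : 0 <= h -> is_alpha p h (alpha p h).
Proof.
  intros [Hh|<-]; apply (iota_correct (is_alpha p _)).
  - destruct (is_alpha_exists p h Hh) as [a Ha]. exists a. split; [exact Ha|].
    intros b Hb. now apply (is_alpha_unique p h).
  - exists (INR p * PI). split; [left; auto|].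
    intros b [[_ E]|[E _]]; [now symmetry|lra].
Qed.

Lemma alpha_zero (p : nat) : alpha p 0 = INR p * PI.
Proof.
  destruct (alpha_spec p 0 (Rle_refl 0)) as [[_ E]|[E _]]; [exact E|lra].
Qed.

Lemma alpha_pos (p : nat) (h : R) : 0 < h -> 0 < alpha p h.
Proof.
  intros Hh. now apply (is_alpha_atan p h (alpha p h) Hh), alpha_spec, Rlt_le.
Qed.

Lemma alpha_bounds (p : nat) (h : R) : 0 <= h ->
  INR p * PI <= alpha p h < (INR p + 1) * PI.
Proof.
  intros [Hh|<-].
  - now apply (is_alpha_atan p h (alpha p h) Hh), alpha_spec, Rlt_le.
  - rewrite alpha_zero. pose proof PI_RGT_0. lra.
Qed.

(** At h = 0 and p = 0 the quotient is 0 / 0 = 0, so that the formula still holds. *)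
Lemma alpha_atan (p : nat) (h : R) : 0 <= h ->
  alpha p h = INR p * PI + 2 * atan (h * PI / alpha p h).
Proof.
  intros [Hh|<-].
  - now apply (is_alpha_atan p h (alpha p h) Hh), alpha_spec, Rlt_le.
  - rewrite alpha_zero. unfold Rdiv. rewrite Rmult_0_l, Rmult_0_l, atan_0. ring.
Qed.

Lemma alpha_nonneg (p : nat) (h : R) : 0 <= h -> 0 <= alpha p h.
Proof.
  intros Hh. pose proof (alpha_bounds p h Hh). pose proof (pos_INR p).
  pose proof PI_RGT_0. nra.
Qed.

Lemma alpha_lt (p q : nat) (h : R) : 0 <= h -> (p < q)%nat -> alpha p h < alpha q h.
Proof.
  intros Hh Hpq. pose proof (alpha_bounds p h Hh). pose proof (alpha_bounds q h Hh).
  assert (INR p + 1 <= INR q) by (rewrite <- S_INR; apply le_INR; lia).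
  pose proof PI_RGT_0. nra.
Qed.

Lemma alpha_le (p q : nat) (h : R) : 0 <= h -> (p <= q)%nat -> alpha p h <= alpha q h.
Proof.
  intros Hh Hpq. apply Nat.lt_eq_cases in Hpq as [L| ->]; [|lra].
  now apply Rlt_le, alpha_lt.
Qed.

Lemma alpha_half_angle (p : nat) (h : R) : 0 <= h ->
  let t := (alpha p h - INR p * PI) / 2 in
  0 <= t < PI / 2 /\ alpha p h * sin t = h * PI * cos t.
Proof.
  intros Hh t. pose proof (alpha_bounds p h Hh) as Hb.
  split; [unfold t; lra|].
  destruct Hh as [Hh|<-].
  - pose proof (alpha_pos p h Hh) as Ha.
    assert (Et : t = atan (h * PI / alpha p h)).
    { unfold t. pose proof (alpha_atan p h (Rlt_le _ _ Hh)). lra. }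
    assert (Hc : 0 < cos t) by (apply cos_gt_0; unfold t; lra).
    assert (T : tan t = h * PI / alpha p h) by (rewrite Et; apply tan_atan).
    unfold tan in T.
    assert (E : sin t = h * PI / alpha p h * cos t) by (rewrite <- T; field; lra).
    rewrite E. field. lra.
  - replace t with 0 by (unfold t; rewrite alpha_zero; field).
    rewrite sin_0. ring.
Qed.

Lemma alpha_excess_antitone (p q : nat) (h : R) : 0 <= h -> (p <= q)%nat ->
  alpha q h - INR q * PI <= alpha p h - INR p * PI.
Proof.
  intros Hh Hpq. pose proof (alpha_le p q h Hh Hpq) as Hle.
  destruct Hh as [Hh|<-]; [|rewrite !alpha_zero; lra].
  pose proof (alpha_pos p h Hh). pose proof PI_RGT_0.
  rewrite (alpha_atan p h), (alpha_atan q h) at 1 by lra.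
  enough (atan (h * PI / alpha q h) <= atan (h * PI / alpha p h)) by lra.
  apply atan_le, Rmult_le_compat_l; [nra|]. apply Rinv_le_contravar; lra.
Qed.

Lemma atan_lipschitz (x y : R) : x <= y -> atan y - atan x <= y - x.
Proof.
  intros Hxy.
  destruct (MVT_gen atan x y (fun z => / (1 + z ^ 2))) as [c [_ E]].
  - intros z _. auto_derive; [trivial|field; nra].
  - intros z _. apply derivable_continuous_pt, derivable_pt_atan.
  - rewrite E. assert (/ (1 + c ^ 2) <= / 1) by (apply Rinv_le_contravar; nra).
    rewrite Rinv_1 in H. nra.
Qed.

(** The derivative of 2 atan (H / z) has absolute value
    2 H / (z^2 + H^2) <= 1 / z, so theta_p - theta_q is at most
    (alpha_q - alpha_p) / alpha_p, and alpha_q - alpha_p <= (q - p) pi.  The bound does not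
    depend on h, which is what makes the comparisons below uniform. *)
Lemma alpha_excess_diff (p q : nat) (h : R) : 0 <= h -> (0 < p)%nat -> (p <= q)%nat ->
  (alpha p h - INR p * PI) - (alpha q h - INR q * PI) <= (INR q - INR p) / INR p.
Proof.
  intros Hh Hp Hpq. pose proof PI_RGT_0 as Hpi.
  assert (P0 : 0 < INR p) by (now apply lt_0_INR).
  assert (Pq : INR p <= INR q) by (now apply le_INR).
  pose proof (alpha_excess_antitone p q h Hh Hpq) as Hex.
  pose proof (alpha_le p q h Hh Hpq) as Hle.
  pose proof (alpha_bounds p h Hh) as Hb.
  assert (Ha : 0 < alpha p h) by nra.
  set (a := alpha p h) in *. set (b := alpha q h) in *.
  assert (Hgap : (b - a) / a <= (INR q - INR p) / INR p).
  { apply Rle_trans with ((INR q - INR p) * PI / (INR p * PI)).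
    - apply Rmult_le_compat; try lra.
      + left. now apply Rinv_0_lt_compat.
      + apply Rinv_le_contravar; nra.
    - right. field. lra. }
  apply Rle_trans with ((b - a) / a); [|exact Hgap].
  replace (a - INR p * PI - (b - INR q * PI))
    with (2 * (atan (h * PI / a) - atan (h * PI / b))).
  2:{ pose proof (alpha_atan p h Hh) as E1. pose proof (alpha_atan q h Hh) as E2.
      fold a in E1. fold b in E2. lra. }
  destruct (MVT_gen (fun z => 2 * atan (h * PI / z)) b a
              (fun z => - (2 * (h * PI) / (z ^ 2 + (h * PI) ^ 2)))) as [c [Hc E]].
  - intros z Hz. rewrite Rmin_right, Rmax_left in Hz by lra.
    auto_derive; [lra|]. field. split; nra.
  - intros z Hz. rewrite Rmin_right, Rmax_left in Hz by lra.
    apply continuity_pt_filterlim, (ex_derive_continuous (fun z => 2 * atan (h * PI / z))).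
    auto_derive. lra.
  - rewrite Rmin_right, Rmax_left in Hc by lra.
    replace (2 * (atan (h * PI / a) - atan (h * PI / b)))
      with (2 * atan (h * PI / a) - 2 * atan (h * PI / b)) by ring.
    rewrite E.
    replace (- (2 * (h * PI) / (c ^ 2 + (h * PI) ^ 2)) * (a - b))
      with ((b - a) * (2 * (h * PI) / (c ^ 2 + (h * PI) ^ 2))) by ring.
    apply Rmult_le_compat_l; [lra|].
    set (H := h * PI). apply Rle_trans with (/ c).
    + assert (Hc0 : 0 < c) by lra.
      assert (HS : 0 < c ^ 2 + H ^ 2) by nra.
      apply Rmult_le_reg_r with ((c ^ 2 + H ^ 2) * c); [nra|].
      replace (2 * H / (c ^ 2 + H ^ 2) * ((c ^ 2 + H ^ 2) * c)) with (2 * H * c) by (field; lra).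
      replace (/ c * ((c ^ 2 + H ^ 2) * c)) with (c ^ 2 + H ^ 2) by (field; lra).
      pose proof (pow2_ge_0 (c - H)). nra.
    + apply Rinv_le_contravar; lra.
Qed.

(** * Comparisons valid for every h *)

Lemma cos_ge_quadratic (x : R) : 0 <= x -> 1 - x ^ 2 / 2 <= cos x.
Proof.
  intros [Hx|<-]; [|rewrite cos_0; lra].
  replace (cos x) with (cos (2 * (x / 2))) by (f_equal; field).
  rewrite cos_2a_sin.
  destruct (Rle_dec x 2) as [H2|H2].
  - pose proof (sin_lt_x (x / 2)). pose proof PI2_3_2.
    assert (0 <= sin (x / 2)) by (apply sin_ge_0; lra). nra.
  - pose proof (SIN_bound (x / 2)). nra.
Qed.

(** Compares the excess theta_0 = alpha_0 with theta_3.  On the one hand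
    theta_0 tan (theta_0 / 2) = H gives theta_0^2 <= 2 H.  On the other hand, if
    theta_3 < theta_0^2 / (4 pi) <= pi / 4, the tangent of theta_3 / 2 is hardly larger
    than its argument, so that H = alpha_3 tan (theta_3 / 2) < 2 pi theta_3 < theta_0^2 / 2, a
    contradiction. *)
Lemma excess_zero_sqr_le (h : R) : 0 <= h ->
  alpha 0 h ^ 2 <= 4 * PI * (alpha 3 h - 3 * PI).
Proof.
  intros Hh. pose proof PI2_3_2 as Hpi. pose proof PI_4 as Hpi4.
  destruct Hh as [Hh|<-].
  2:{ rewrite !alpha_zero. simpl. lra. }
  assert (Hh0 : 0 <= h) by lra.
  pose proof (alpha_pos 0 h Hh) as Ha. pose proof (alpha_bounds 0 h Hh0) as Hb.
  pose proof (alpha_atan 0 h Hh0) as E0.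
  destruct (alpha_half_angle 3 h Hh0) as [Ht Es]. simpl INR in *.
  pose proof (alpha_bounds 3 h Hh0) as Hb3. simpl INR in Hb3.
  set (a := alpha 0 h) in *. set (t := (alpha 3 h - (1 + 1 + 1) * PI) / 2) in *.
  assert (Ea3 : alpha 3 h = 3 * PI + 2 * t) by (unfold t; field).
  rewrite Ea3 in *. set (H := h * PI) in *.
  assert (HH : 0 < H) by (unfold H; nra).
  assert (HaH : a ^ 2 <= 2 * H).
  { pose proof (atan_lipschitz 0 (H / a)) as L. rewrite atan_0 in L.
    assert (0 <= H / a) by (apply Rlt_le, Rdiv_lt_0_compat; lra).
    specialize (L H0).
    assert (E : H / a * a = H) by (field; lra). nra. }
  destruct (Rle_dec (a ^ 2) (4 * PI * (3 * PI + 2 * t - 3 * PI))) as [|N]; [assumption|exfalso].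
  assert (N' : 8 * PI * t < a ^ 2) by nra.
  assert (Ht2 : t <= 1 / 2) by nra.
  pose proof (cos_ge_quadratic t (proj1 Ht)) as Hc.
  assert (Hs : sin t <= t).
  { destruct (proj1 Ht) as [L|<-]; [left; now apply sin_lt_x|rewrite sin_0; lra]. }
  assert (Hc' : 7 / 8 <= cos t) by nra.
  assert (H * (7 / 8) <= (3 * PI + 2 * t) * t).
  { apply Rle_trans with (H * cos t); [nra|]. rewrite <- Es. apply Rmult_le_compat_l; lra. }
  nra.
Qed.

(** The only comparison that is an equality at h = 0 (25 = 16 + 9), hence the one that needs
    the sharp estimate [excess_zero_sqr_le]: with theta_5 <= theta_4 <= theta_3,
    alpha_5^2 - alpha_4^2 <= 9 pi^2 + 2 pi theta_5, while
    alpha_3^2 - alpha_0^2 >= 9 pi^2 + 6 pi theta_3 - alpha_0^2. *)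
Lemma alpha50_le_43 (h : R) : 0 <= h ->
  alpha 5 h ^ 2 + alpha 0 h ^ 2 <= alpha 4 h ^ 2 + alpha 3 h ^ 2.
Proof.
  intros Hh. pose proof PI_RGT_0.
  pose proof (excess_zero_sqr_le h Hh).
  pose proof (alpha_excess_antitone 3 4 h Hh ltac:(lia)).
  pose proof (alpha_excess_antitone 4 5 h Hh ltac:(lia)).
  pose proof (alpha_bounds 3 h Hh). pose proof (alpha_bounds 4 h Hh). pose proof (alpha_bounds 5 h Hh).
  simpl INR in *.
  set (x := alpha 3 h - 3 * PI) in *. set (y := alpha 4 h - 4 * PI). set (z := alpha 5 h - 5 * PI).
  replace (alpha 3 h) with (3 * PI + x) in * by (unfold x; ring).
  replace (alpha 4 h) with (4 * PI + y) in * by (unfold y; ring).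
  replace (alpha 5 h) with (5 * PI + z) in * by (unfold z; ring).
  assert (0 <= z <= y) by lra. assert (y <= x) by lra.
  assert (z * z <= y * y) by nra. nra.
Qed.

Lemma alpha_sqr_gap_lower (p q : nat) (h : R) : 0 <= h -> (0 < p)%nat -> (p <= q)%nat ->
  (INR q - INR p) * (PI - / INR p) * ((INR p + INR q) * PI) <= alpha q h ^ 2 - alpha p h ^ 2.
Proof.
  intros Hh Hp Hpq. pose proof PI_RGT_0. pose proof PI2_3_2.
  pose proof (alpha_excess_diff p q h Hh Hp Hpq) as Hd.
  pose proof (alpha_bounds p h Hh). pose proof (alpha_bounds q h Hh).
  pose proof (alpha_le p q h Hh Hpq).
  assert (1 <= INR p) by (apply (le_INR 1); lia).
  assert (INR p <= INR q) by now apply le_INR.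
  replace ((INR q - INR p) * (PI - / INR p)) with ((INR q - INR p) * PI - (INR q - INR p) / INR p)
    by (field; lra).
  replace (alpha q h ^ 2 - alpha p h ^ 2)
    with ((alpha q h - alpha p h) * (alpha p h + alpha q h)) by ring.
  assert ((INR q - INR p) * PI - (INR q - INR p) / INR p <= alpha q h - alpha p h) by lra.
  apply Rle_trans with ((alpha q h - alpha p h) * ((INR p + INR q) * PI)).
  - apply Rmult_le_compat_r; [nra|assumption].
  - apply Rmult_le_compat_l; [lra|lra].
Qed.

Lemma alpha_sqr_gap_upper (p q : nat) (h : R) : 0 <= h -> (p <= q)%nat ->
  alpha q h ^ 2 - alpha p h ^ 2 <= (INR q - INR p) * PI * ((INR p + INR q + 2) * PI).
Proof.
  intros Hh Hpq. pose proof PI_RGT_0.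
  pose proof (alpha_excess_antitone p q h Hh Hpq) as Hd.
  pose proof (alpha_bounds p h Hh). pose proof (alpha_bounds q h Hh).
  pose proof (alpha_le p q h Hh Hpq).
  pose proof (alpha_nonneg p h Hh).
  replace (alpha q h ^ 2 - alpha p h ^ 2)
    with ((alpha q h - alpha p h) * (alpha p h + alpha q h)) by ring.
  apply Rmult_le_compat; lra.
Qed.

Lemma alpha42_le_51 (h : R) : 0 <= h ->
  alpha 4 h ^ 2 + alpha 2 h ^ 2 <= alpha 5 h ^ 2 + alpha 1 h ^ 2.
Proof.
  intros Hh. pose proof PI2_3_2.
  pose proof (alpha_sqr_gap_lower 4 5 h Hh ltac:(lia) ltac:(lia)) as L.
  pose proof (alpha_sqr_gap_upper 1 2 h Hh ltac:(lia)) as U.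
  simpl INR in *. nra.
Qed.

Lemma alpha33_le_51 (h : R) : 0 <= h ->
  alpha 3 h ^ 2 + alpha 3 h ^ 2 <= alpha 5 h ^ 2 + alpha 1 h ^ 2.
Proof.
  intros Hh. pose proof PI2_3_2.
  pose proof (alpha_sqr_gap_lower 3 5 h Hh ltac:(lia) ltac:(lia)) as L.
  pose proof (alpha_sqr_gap_upper 1 3 h Hh ltac:(lia)) as U.
  simpl INR in *. nra.
Qed.

Lemma alpha51_le_60 (h : R) : 0 <= h ->
  alpha 5 h ^ 2 + alpha 1 h ^ 2 <= alpha 6 h ^ 2 + alpha 0 h ^ 2.
Proof.
  intros Hh. pose proof PI2_3_2.
  pose proof (alpha_sqr_gap_lower 5 6 h Hh ltac:(lia) ltac:(lia)) as L.
  pose proof (alpha_sqr_gap_upper 0 1 h Hh ltac:(lia)) as U.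
  simpl INR in *. nra.
Qed.

(** * The crossing of the values of (4, 3) and (5, 1) *)

Definition crossing (h : R) : R :=
  alpha 4 h ^ 2 + alpha 3 h ^ 2 - (alpha 5 h ^ 2 + alpha 1 h ^ 2).

Lemma crossing_zero : crossing 0 < 0.
Proof.
  unfold crossing. rewrite !alpha_zero. simpl INR. pose proof PI_RGT_0. nra.
Qed.

Lemma alpha_le_small (p : nat) (h : R) : 0 < h -> (0 < p)%nat ->
  alpha p h <= INR p * PI + 2 * h / INR p.
Proof.
  intros Hh Hp. pose proof PI_RGT_0.
  assert (P0 : 0 < INR p) by (now apply lt_0_INR).
  assert (Hh0 : 0 <= h) by lra.
  pose proof (alpha_bounds p h Hh0). pose proof (alpha_pos p h Hh).
  rewrite alpha_atan by lra.
  assert (K : 0 <= h * PI / alpha p h) by (apply Rlt_le, Rdiv_lt_0_compat; nra).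
  pose proof (atan_lipschitz 0 _ K) as L. rewrite atan_0 in L.
  assert (h * PI / alpha p h <= h * PI / (INR p * PI)).
  { apply Rmult_le_compat_l; [nra|]. apply Rinv_le_contravar; nra. }
  replace (h * PI / (INR p * PI)) with (h / INR p) in H2 by (field; lra). lra.
Qed.

Lemma alpha_ge_large (p : nat) (h : R) : 0 < h ->
  (INR p + 1) * (PI - 2 / h) <= alpha p h.
Proof.
  intros Hh. pose proof PI_RGT_0. pose proof (pos_INR p).
  assert (Hh0 : 0 <= h) by lra.
  pose proof (alpha_bounds p h Hh0). pose proof (alpha_pos p h Hh) as Ha.
  pose proof (alpha_atan p h Hh0) as E.
  assert (K : 0 < alpha p h / (h * PI)) by (apply Rdiv_lt_0_compat; nra).
  pose proof (atan_inv _ K) as I.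
  replace (/ (alpha p h / (h * PI))) with (h * PI / alpha p h) in I by (field; nra).
  pose proof (atan_lipschitz 0 _ (Rlt_le _ _ K)) as L. rewrite atan_0 in L.
  assert (alpha p h / (h * PI) <= (INR p + 1) / h).
  { apply Rmult_le_reg_r with (h * PI); [nra|].
    replace (alpha p h / (h * PI) * (h * PI)) with (alpha p h) by (field; nra).
    replace ((INR p + 1) / h * (h * PI)) with ((INR p + 1) * PI) by (field; lra). lra. }
  replace ((INR p + 1) * (PI - 2 / h)) with ((INR p + 1) * PI - 2 * ((INR p + 1) / h)) by (field; lra).
  lra.
Qed.

Lemma crossing_small : crossing (1 / 8) < 0.
Proof.
  unfold crossing. pose proof PI2_3_2. pose proof PI_4.
  assert (H8 : 0 < 1 / 8) by lra. assert (H8' : 0 <= 1 / 8) by lra.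
  pose proof (alpha_le_small 4 _ H8 ltac:(lia)). pose proof (alpha_le_small 3 _ H8 ltac:(lia)).
  pose proof (alpha_bounds 4 _ H8'). pose proof (alpha_bounds 3 _ H8').
  pose proof (alpha_bounds 5 _ H8'). pose proof (alpha_bounds 1 _ H8').
  simpl INR in *.
  assert (alpha 4 (1/8) ^ 2 <= (4 * PI + 1 / 16) ^ 2) by (apply pow_incr; lra).
  assert (alpha 3 (1/8) ^ 2 <= (3 * PI + 1 / 12) ^ 2) by (apply pow_incr; lra).
  assert ((5 * PI) ^ 2 <= alpha 5 (1/8) ^ 2) by (apply pow_incr; lra).
  assert (PI ^ 2 <= alpha 1 (1/8) ^ 2) by (apply pow_incr; lra).
  nra.
Qed.

Lemma crossing_large : 0 < crossing 100.
Proof.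
  unfold crossing. pose proof PI2_3_2. pose proof PI_4.
  assert (H8 : 0 < 100) by lra. assert (H8' : 0 <= 100) by lra.
  pose proof (alpha_ge_large 4 _ H8). pose proof (alpha_ge_large 3 _ H8).
  pose proof (alpha_bounds 5 _ H8'). pose proof (alpha_bounds 1 _ H8').
  simpl INR in *.
  assert ((5 * (PI - 1 / 50)) ^ 2 <= alpha 4 100 ^ 2) by (apply pow_incr; lra).
  assert ((4 * (PI - 1 / 50)) ^ 2 <= alpha 3 100 ^ 2) by (apply pow_incr; lra).
  assert (alpha 5 100 ^ 2 <= (6 * PI) ^ 2) by (apply pow_incr; lra).
  assert (alpha 1 100 ^ 2 <= (2 * PI) ^ 2) by (apply pow_incr; lra).
  nra.
Qed.

(** Carathéodory's argument: the difference quotient of g at f x extends to a continuous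
    function q with q (f x) = l, and 1 / q (f t) is the difference quotient of f. *)
Lemma is_derive_right_inverse (f g : R -> R) (x l : R) : l <> 0 ->
  continuous f x -> is_derive g (f x) l -> locally x (fun t => g (f t) = t) ->
  is_derive f x (/ l).
Proof.
  intros Hl Cf Dg Hgf.
  set (q := fun a => if Req_dec_T a (f x) then l else (g a - g (f x)) / (a - f x)).
  assert (Hq : filterlim q (locally (f x)) (locally l)).
  { apply filterlim_locally. intros eps.
    apply is_derive_Reals in Dg. destruct (Dg eps (cond_pos eps)) as [d Hd].
    exists d. cut (forall y : R, Rabs (y - f x) < d -> Rabs (q y - l) < eps); [trivial|].
    intros y Hy. unfold q. destruct (Req_dec_T y (f x)) as [E|N].
    - replace (l - l) with 0 by ring. rewrite Rabs_R0. apply cond_pos.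
    - specialize (Hd (y - f x)).
      replace (f x + (y - f x)) with y in Hd by ring.
      apply Hd; [lra|]. exact Hy. }
  assert (Hr : filterlim (fun t => / q (f t)) (locally x) (locally (/ l))).
  { apply (filterlim_comp _ _ _ (fun t => q (f t)) Rinv _ (locally l)).
    - now apply (filterlim_comp _ _ _ f q _ (locally (f x))).
    - apply (filterlim_Rbar_inv l). now intros [= E]. }
  assert (Hfx : g (f x) = x) by exact (locally_singleton _ _ Hgf).
  apply is_derive_Reals. intros eps Heps.
  assert (He2 : 0 < Rabs (/ l)) by (apply Rabs_pos_lt; now apply Rinv_neq_0_compat).
  assert (He3 : 0 < Rmin eps (Rabs (/ l))) by (now apply Rmin_glb_lt).
  pose proof (proj1 (filterlim_locally _ _) Hr (mkposreal _ He3)) as HL.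
  destruct (filter_and _ _ HL Hgf) as [d Hd].
  exists d. intros k Hk Hkd.
  destruct (Hd (x + k)) as [B G].
  { change (Rabs (x + k - x) < d). now replace (x + k - x) with k by ring. }
  change (Rabs (/ q (f (x + k)) - / l) < Rmin eps (Rabs (/ l))) in B.
  replace ((f (x + k) - f x) / k) with (/ q (f (x + k))).
  { apply Rlt_le_trans with (1 := B), Rmin_l. }
  assert (N : f (x + k) <> f x) by (intros E; rewrite E in G; lra).
  unfold q. destruct (Req_dec_T (f (x + k)) (f x)) as [E|_]; [contradiction|].
  rewrite G, Hfx. replace (x + k - x) with k by ring. field. split; lra.
Qed.

Lemma alpha_mono (p : nat) (h k : R) : 0 < h -> h <= k -> alpha p h <= alpha p k.
Proof.
  intros Hh Hk. assert (Hk0 : 0 < k) by lra.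
  destruct (Rle_dec (alpha p h) (alpha p k)) as [|N]; [assumption|exfalso].
  pose proof (alpha_pos p h Hh). pose proof (alpha_pos p k Hk0). pose proof PI_RGT_0.
  assert (h * PI / alpha p h <= k * PI / alpha p k).
  { apply Rmult_le_compat; [nra| |nra|].
    - left. now apply Rinv_0_lt_compat.
    - apply Rinv_le_contravar; lra. }
  apply atan_le in H2.
  pose proof (alpha_atan p h). pose proof (alpha_atan p k). lra.
Qed.

(** Local Lipschitz continuity in h, from the fixed-point equation for alpha. *)
Lemma alpha_increment (p : nat) (h k : R) : 0 < h -> h <= k ->
  alpha p k - alpha p h <= 2 * PI / alpha p h * (k - h).
Proof.
  intros Hh Hk. assert (Hk0 : 0 < k) by lra.
  pose proof (alpha_pos p h Hh). pose proof (alpha_pos p k Hk0). pose proof PI_RGT_0.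
  pose proof (alpha_mono p h k Hh Hk).
  assert (A : k * PI / alpha p k <= k * PI / alpha p h).
  { apply Rmult_le_compat_l; [nra|]. apply Rinv_le_contravar; lra. }
  apply atan_le in A.
  assert (B : h * PI / alpha p h <= k * PI / alpha p h).
  { apply Rmult_le_compat_r; [|nra]. left. now apply Rinv_0_lt_compat. }
  apply atan_lipschitz in B.
  pose proof (alpha_atan p h). pose proof (alpha_atan p k).
  replace (2 * PI / alpha p h * (k - h)) with (2 * (k * PI / alpha p h - h * PI / alpha p h))
    by (field; lra).
  lra.
Qed.

Lemma alpha_continuous (p : nat) (h : R) : 0 < h -> continuous (alpha p) h.
Proof.
  intros Hh. apply continuity_pt_filterlim.
  assert (Hh2 : 0 < h / 2) by lra.
  pose proof (alpha_pos p _ Hh2) as Hm. pose proof PI_RGT_0 as Hpi.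
  set (L := 2 * PI / alpha p (h / 2)).
  assert (HL : 0 < L) by (apply Rdiv_lt_0_compat; lra).
  assert (G : forall x y, h / 2 <= x -> x <= y -> 0 <= alpha p y - alpha p x <= L * (y - x)).
  { intros x y Hx Hy. assert (Hx0 : 0 < x) by lra. split.
    - pose proof (alpha_mono p x y Hx0 Hy). lra.
    - apply Rle_trans with (1 := alpha_increment p x y Hx0 Hy).
      apply Rmult_le_compat_r; [lra|]. apply Rmult_le_compat_l; [lra|].
      apply Rinv_le_contravar; [assumption|]. now apply alpha_mono. }
  intros eps He. exists (Rmin (h / 2) (eps / L)). split.
  { apply Rmin_glb_lt; [lra|]. now apply Rdiv_lt_0_compat. }
  intros x [_ Hx]. change (Rabs (x - h) < Rmin (h / 2) (eps / L)) in Hx.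
  change (Rabs (alpha p x - alpha p h) < eps).
  assert (Hx1 : Rabs (x - h) < h / 2) by (eapply Rlt_le_trans; [exact Hx|apply Rmin_l]).
  assert (Hx2 : Rabs (x - h) < eps / L) by (eapply Rlt_le_trans; [exact Hx|apply Rmin_r]).
  apply Rabs_def2 in Hx1.
  assert (Hx3 : L * Rabs (x - h) < eps).
  { replace eps with (L * (eps / L)) by (field; lra). now apply Rmult_lt_compat_l. }
  destruct (Rle_dec x h) as [Hle|Hle].
  - pose proof (G x h ltac:(lra) Hle). rewrite Rabs_left1 in Hx3 by lra.
    apply Rabs_def1; lra.
  - pose proof (G h x ltac:(lra) ltac:(lra)). rewrite Rabs_pos_eq in Hx3 by lra.
    apply Rabs_def1; lra.
Qed.

(** Here alpha_p inverts a |-> a tan ((a - p pi) / 2) / pi, whose derivative is rewritten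
    with tan (theta_p / 2) = H / alpha_p. *)
Lemma alpha_derive (p : nat) (h : R) : 0 < h ->
  is_derive (alpha p) h
    (2 * PI * alpha p h / (alpha p h ^ 2 + (h * PI) ^ 2 + 2 * (h * PI))).
Proof.
  intros Hh. pose proof PI_RGT_0 as Hpi. pose proof (alpha_pos p h Hh) as Ha.
  assert (Hh0 : 0 <= h) by lra.
  destruct (alpha_half_angle p h Hh0) as [Ht E].
  set (a := alpha p h) in *. set (t := (a - INR p * PI) / 2) in *.
  assert (Hc : 0 < cos t) by (apply cos_gt_0; lra).
  assert (Es : sin t = h * PI * cos t / a) by (rewrite <- E; field; lra).
  assert (Ht2 : cos t ^ 2 * ((h * PI) ^ 2 + a ^ 2) = a ^ 2).
  { pose proof (sin2_cos2 t) as S2. unfold Rsqr in S2. rewrite Es in S2.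
    apply (f_equal (fun z => z * a ^ 2)) in S2.
    replace ((h * PI * cos t / a * (h * PI * cos t / a) + cos t * cos t) * a ^ 2)
      with (cos t ^ 2 * ((h * PI) ^ 2 + a ^ 2)) in S2 by (field; lra). lra. }
  assert (HS : 0 < a ^ 2 + (h * PI) ^ 2 + 2 * (h * PI)) by nra.
  assert (Hl : (a ^ 2 + (h * PI) ^ 2 + 2 * (h * PI)) / (2 * PI * a) <> 0).
  { apply Rgt_not_eq, Rdiv_lt_0_compat; nra. }
  replace (2 * PI * a / (a ^ 2 + (h * PI) ^ 2 + 2 * (h * PI)))
    with (/ ((a ^ 2 + (h * PI) ^ 2 + 2 * (h * PI)) / (2 * PI * a))) by (field; split; lra).
  apply (is_derive_right_inverse (alpha p)
    (fun a => a * sin ((a - INR p * PI) / 2) / (PI * cos ((a - INR p * PI) / 2)))).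
  - exact Hl.
  - now apply alpha_continuous.
  - fold a. auto_derive.
    + change ((a + - (INR p * PI)) * / 2) with t. apply Rgt_not_eq. nra.
    + change ((a + - (INR p * PI)) * / 2) with t.
      pose proof (sin2_cos2 t) as S2. unfold Rsqr in S2.
      transitivity ((2 * sin t * cos t + a * (sin t * sin t + cos t * cos t)) / (2 * PI * cos t ^ 2));
        [field; lra|].
      rewrite S2, Es.
      apply Rmult_eq_reg_r with (2 * PI * a * cos t ^ 2);
        [|apply Rgt_not_eq, Rmult_lt_0_compat; [nra|now apply pow_lt]].
      transitivity (2 * (h * PI) * cos t ^ 2 + a ^ 2); [field; lra|].
      transitivity (cos t ^ 2 * ((h * PI) ^ 2 + a ^ 2) + 2 * (h * PI) * cos t ^ 2);
        [rewrite Ht2; ring|field; lra].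
  - exists (mkposreal h Hh). intros k Hk.
    change (Rabs (k - h) < h) in Hk. apply Rabs_def2 in Hk.
    assert (Hk0 : 0 < k) by lra.
    destruct (alpha_half_angle p k (Rlt_le _ _ Hk0)) as [Hk1 Ek].
    set (s := (alpha p k - INR p * PI) / 2) in *.
    assert (0 < cos s) by (apply cos_gt_0; lra).
    rewrite Ek. field. split; lra.
Qed.

(** With A_p = alpha_p^2 and s = H^2 + 2 H, A_p' = 4 pi A_p / (A_p + s).  If
    A_4 + A_3 >= A_5 + A_1, then A_3 - A_1 >= A_5 - A_4, and concavity of
    A |-> A / (A + s) makes the gain from A_1 to A_3 exceed that from A_4 to A_5. *)
Lemma crossing_derive_pos (h : R) : 0 < h -> 0 <= crossing h ->
  exists l, is_derive crossing h l /\ 0 < l.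
Proof.
  intros Hh HD. pose proof PI_RGT_0 as Hpi.
  set (s := (h * PI) ^ 2 + 2 * (h * PI)).
  assert (Hs : 0 < s) by (unfold s; nra).
  assert (D2 : forall p, is_derive (fun k => alpha p k ^ 2) h
      (4 * PI * (alpha p h ^ 2 / (alpha p h ^ 2 + s)))).
  { intros p. pose proof (alpha_pos p h Hh).
    replace (4 * PI * (alpha p h ^ 2 / (alpha p h ^ 2 + s)))
      with (INR 2 * (2 * PI * alpha p h / (alpha p h ^ 2 + (h * PI) ^ 2 + 2 * (h * PI)))
             * alpha p h ^ Nat.pred 2).
    - apply is_derive_pow, alpha_derive, Hh.
    - unfold s. simpl. field. nra. }
  exists (4 * PI * (alpha 4 h ^ 2 / (alpha 4 h ^ 2 + s)) + 4 * PI * (alpha 3 h ^ 2 / (alpha 3 h ^ 2 + s))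
       - (4 * PI * (alpha 5 h ^ 2 / (alpha 5 h ^ 2 + s)) + 4 * PI * (alpha 1 h ^ 2 / (alpha 1 h ^ 2 + s)))).
  split.
  - apply (is_derive_minus (fun k => alpha 4 k ^ 2 + alpha 3 k ^ 2) (fun k => alpha 5 k ^ 2 + alpha 1 k ^ 2)).
    + apply (is_derive_plus (fun k => alpha 4 k ^ 2) (fun k => alpha 3 k ^ 2)); apply D2.
    + apply (is_derive_plus (fun k => alpha 5 k ^ 2) (fun k => alpha 1 k ^ 2)); apply D2.
  - unfold crossing in HD.
    assert (Hh0 : 0 <= h) by lra.
    pose proof (alpha_pos 1 h Hh).
    pose proof (alpha_lt 1 3 h Hh0 ltac:(lia)). pose proof (alpha_lt 3 4 h Hh0 ltac:(lia)).
    pose proof (alpha_lt 4 5 h Hh0 ltac:(lia)).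
    assert (S1 : 0 < alpha 1 h ^ 2) by nra.
    assert (S3 : alpha 1 h ^ 2 < alpha 3 h ^ 2) by nra.
    assert (S4 : alpha 3 h ^ 2 < alpha 4 h ^ 2) by nra.
    assert (S5 : alpha 4 h ^ 2 < alpha 5 h ^ 2) by nra.
    generalize dependent (alpha 1 h ^ 2). generalize dependent (alpha 3 h ^ 2).
    generalize dependent (alpha 4 h ^ 2). generalize dependent (alpha 5 h ^ 2).
    intros E D DE C CD B HD B0 BC.
    replace (4 * PI * (D / (D + s)) + 4 * PI * (C / (C + s)) - (4 * PI * (E / (E + s)) + 4 * PI * (B / (B + s))))
      with (4 * PI * s * ((C - B) * / ((C + s) * (B + s)) - (E - D) * / ((D + s) * (E + s))))
      by (field; repeat split; lra).
    apply Rmult_lt_0_compat; [nra|].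
    assert (/ ((D + s) * (E + s)) < / ((C + s) * (B + s))).
    { apply Rinv_lt_contravar; [|nra]. repeat apply Rmult_lt_0_compat; lra. }
    assert (0 < / ((D + s) * (E + s))) by (apply Rinv_0_lt_compat; nra).
    nra.
Qed.

Lemma increase_right (g : R -> R) (x l y : R) : is_derive g x l -> 0 < l -> x < y ->
  exists z, x < z <= y /\ g x < g z.
Proof.
  intros D Hl Hxy. apply is_derive_Reals in D. destruct (D l Hl) as [d Hd].
  pose proof (cond_pos d).
  set (k := Rmin (y - x) (d / 2)).
  assert (0 < k) by (apply Rmin_glb_lt; lra).
  assert (k <= y - x) by apply Rmin_l. assert (k <= d / 2) by apply Rmin_r.
  specialize (Hd k ltac:(lra) ltac:(rewrite Rabs_pos_eq; lra)).
  apply Rabs_def2 in Hd.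
  exists (x + k). split; [lra|].
  assert (E : (g (x + k) - g x) / k * k = g (x + k) - g x) by (field; lra).
  nra.
Qed.

(** A maximum of g over [a, b] is at least g a >= 0, so g increases just after it; it can only be
    attained at b, and g b > g a as g increases after a. *)
Lemma positive_after_zero (g : R -> R) (a b : R) : a < b ->
  (forall x, a <= x <= b -> 0 <= g x -> exists l, is_derive g x l /\ 0 < l) ->
  (forall x, a <= x <= b -> continuity_pt g x) ->
  0 <= g a -> 0 < g b.
Proof.
  intros Hab Hd Hc Ga.
  destruct (continuity_ab_maj g a b (Rlt_le _ _ Hab) Hc) as [m [Hmax Hm]].
  destruct (Req_dec m b) as [->|N].
  - destruct (Hd a ltac:(lra) Ga) as [l [Dl Hl]].
    destruct (increase_right g a l b Dl Hl Hab) as [z [Hz G]].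
    pose proof (Hmax z ltac:(lra)). lra.
  - assert (Gm : 0 <= g m) by (apply Rle_trans with (1 := Ga), Hmax; lra).
    destruct (Hd m Hm Gm) as [l [Dl Hl]].
    destruct (increase_right g m l b Dl Hl ltac:(lra)) as [z [Hz G]].
    pose proof (Hmax z ltac:(lra)). lra.
Qed.

Lemma crossing_continuous (h : R) : 0 < h -> continuity_pt crossing h.
Proof.
  intros Hh.
  assert (C2 : forall p, continuity_pt (fun k => alpha p k ^ 2) h).
  { intros p. apply continuity_pt_filterlim.
    apply (ex_derive_continuous (fun k => alpha p k ^ 2)).
    apply ex_derive_pow. eexists. now apply alpha_derive. }
  apply continuity_pt_minus; apply continuity_pt_plus; apply C2.
Qed.

Lemma crossing_unique : exists hs, 0 < hs /\
  (forall h, 0 <= h <= hs -> crossing h <= 0) /\ (forall h, hs < h -> 0 < crossing h).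
Proof.
  assert (Hpos : forall a b, 0 < a -> a < b -> 0 <= crossing a -> 0 < crossing b).
  { intros a b Ha Hab. apply positive_after_zero; [exact Hab| |].
    - intros x Hx. apply crossing_derive_pos. lra.
    - intros x Hx. apply crossing_continuous. lra. }
  destruct (IVT_interv crossing (1 / 8) 100) as [hs [Hhs E]].
  - intros x Hx. apply crossing_continuous. lra.
  - lra.
  - apply crossing_small.
  - apply crossing_large.
  - exists hs. split; [lra|]. split.
    + intros h [Hh0 Hh]. destruct Hh0 as [Hh0|<-]; [|left; apply crossing_zero].
      destruct Hh as [Hh| ->]; [|lra].
      destruct (Rle_dec (crossing h) 0) as [|N]; [assumption|].
      pose proof (Hpos h hs Hh0 Hh). lra.
    + intros h Hh. apply (Hpos hs); lra.
Qed.

(** * Finite sums and linear dependence *)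

(** The shape of the sum in [lin_comb], over arbitrary lists of indices. *)
Definition lsum {A : Type} (F : A -> R) (l : list A) : R := fold_right Rplus 0 (map F l).

Lemma lsum_cons {A} (F : A -> R) x l : lsum F (x :: l) = F x + lsum F l.
Proof. reflexivity. Qed.

Lemma lsum_ext {A} (F G : A -> R) l : (forall x, In x l -> F x = G x) -> lsum F l = lsum G l.
Proof.
  induction l as [|x l IH]; intros E; [reflexivity|].
  rewrite !lsum_cons, IH, E; simpl; auto. intros y Hy. apply E. now right.
Qed.

Lemma lsum_plus {A} (F G : A -> R) l : lsum (fun x => F x + G x) l = lsum F l + lsum G l.
Proof.
  induction l as [|x l IH]; [unfold lsum; simpl; lra|]. rewrite !lsum_cons, IH. lra.
Qed.

Lemma lsum_scal {A} (k : R) (F : A -> R) l : lsum (fun x => k * F x) l = k * lsum F l.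
Proof.
  induction l as [|x l IH]; [unfold lsum; simpl; lra|]. rewrite !lsum_cons, IH. lra.
Qed.

Lemma lsum_zero {A} (F : A -> R) l : (forall x, In x l -> F x = 0) -> lsum F l = 0.
Proof.
  intros E. rewrite (lsum_ext F (fun _ => 0 * 0)).
  - rewrite lsum_scal. lra.
  - intros x Hx. rewrite E by assumption. lra.
Qed.

Lemma lsum_middle {A} (F : A -> R) l1 x l2 :
  lsum F (l1 ++ x :: l2) = F x + lsum F (l1 ++ l2).
Proof.
  induction l1 as [|y l1 IH]; [reflexivity|].
  simpl. rewrite !lsum_cons, IH. lra.
Qed.

Lemma lsum_single {A} (F : A -> R) l x : NoDup l -> In x l ->
  (forall y, In y l -> y <> x -> F y = 0) -> lsum F l = F x.
Proof.
  intros Hn Hx H0. apply in_split in Hx as [l1 [l2 ->]].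
  rewrite lsum_middle, (lsum_zero F (l1 ++ l2)); [lra|].
  intros y Hy. apply H0.
  - apply in_app_iff in Hy. apply in_app_iff. simpl. tauto.
  - intros ->. now apply NoDup_remove_2 in Hn.
Qed.

Lemma lsum_nonpos {A} (F : A -> R) l : (forall x, In x l -> F x <= 0) ->
  lsum F l <= 0 /\ (0 <= lsum F l -> forall x, In x l -> F x = 0).
Proof.
  induction l as [|x l IH]; intros H.
  - split; [unfold lsum; simpl; lra|intros _ x []].
  - rewrite lsum_cons. destruct IH as [IH1 IH2]; [intros; apply H; now right|].
    pose proof (H x (or_introl eq_refl)). split; [lra|].
    intros G y [<-|Hy]; [lra|apply IH2; [lra|assumption]].
Qed.

(** Gaussian elimination: the vectors [V i] for [i] in [l] have only K coordinates, so if
    l is longer than K they satisfy a nontrivial relation.  A vector with nonzero last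
    coordinate serves as pivot to remove that coordinate from the others. *)
Lemma dependent_family (K : nat) : forall (l : list nat) (V : nat -> nat -> R),
  NoDup l -> (K < length l)%nat ->
  exists a : nat -> R, (exists i, In i l /\ a i <> 0) /\
    forall j, (j < K)%nat -> lsum (fun i => a i * V i j) l = 0.
Proof.
  induction K as [|K IH]; intros l V Hn Hl.
  - destruct l as [|i l]; [simpl in Hl; lia|].
    exists (fun _ => 1). split; [exists i; split; [now left|lra]|intros; lia].
  - destruct (classic (exists i, In i l /\ V i K <> 0)) as [[i0 [Hi0 N]]|H0].
    + apply in_split in Hi0 as [l1 [l2 ->]].
      pose proof (NoDup_remove_1 _ _ _ Hn) as Hn'.
      pose proof (NoDup_remove_2 _ _ _ Hn) as Hi.
      destruct (IH (l1 ++ l2) (fun i j => V i j - V i K / V i0 K * V i0 j) Hn') as [a [[i [Hil Ha]] Hs]].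
      { rewrite length_app in *. simpl in Hl. lia. }
      set (s := lsum (fun i => a i * V i K) (l1 ++ l2)).
      exists (fun i => if Nat.eq_dec i i0 then - s / V i0 K else a i). split.
      * exists i. split.
        -- apply in_app_iff in Hil. apply in_app_iff. simpl. tauto.
        -- destruct (Nat.eq_dec i i0) as [E|_]; [now subst|exact Ha].
      * intros j Hj. rewrite lsum_middle.
        destruct (Nat.eq_dec i0 i0) as [_|F]; [|contradiction].
        rewrite (lsum_ext _ (fun i => a i * V i j)).
        2:{ intros x Hx. destruct (Nat.eq_dec x i0) as [->|_]; [contradiction|reflexivity]. }
        assert (D : j = K \/ (j < K)%nat) by lia. destruct D as [->|D].
        -- fold s. field. exact N.
        -- specialize (Hs j D).
           rewrite (lsum_ext _ (fun i => a i * V i j + (- (V i0 j / V i0 K)) * (a i * V i K))) in Hs.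
           2:{ intros x _. field. exact N. }
           rewrite lsum_plus, lsum_scal in Hs. fold s in Hs. rewrite <- Hs. field. exact N.
    + destruct (IH l V Hn) as [a [Ha Hs]]; [lia|].
      exists a. split; [exact Ha|]. intros j Hj.
      assert (D : j = K \/ (j < K)%nat) by lia. destruct D as [->|D]; [|now apply Hs].
      apply lsum_zero. intros i Hi. destruct (Req_dec (V i K) 0) as [E|E].
      * rewrite E. ring.
      * exfalso. eauto.
Qed.

(** * Calculus on the interval (- pi / 2, pi / 2) *)

Lemma cont_plus (f g : R -> R) x : continuous f x -> continuous g x -> continuous (fun t => f t + g t) x.
Proof. apply (continuous_plus f g). Qed.
Lemma cont_minus (f g : R -> R) x : continuous f x -> continuous g x -> continuous (fun t => f t - g t) x.
Proof. apply (continuous_minus f g). Qed.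
Lemma cont_mult (f g : R -> R) x : continuous f x -> continuous g x -> continuous (fun t => f t * g t) x.
Proof. apply (continuous_mult f g). Qed.
Lemma cont_opp (f : R -> R) x : continuous f x -> continuous (fun t => - f t) x.
Proof. apply (continuous_opp f). Qed.
Lemma cont_const (c : R) x : continuous (fun _ : R => c) x.
Proof. apply continuous_const. Qed.
Lemma cont_lsum {A} (F : A -> R -> R) l x : (forall i, continuous (F i) x) ->
  continuous (fun t => lsum (fun i => F i t) l) x.
Proof.
  intros H. induction l as [|i l IH]; [apply cont_const|].
  apply (continuous_ext (fun t => F i t + lsum (fun i => F i t) l)); [reflexivity|].
  now apply cont_plus.
Qed.

Ltac cont := intros; cbv beta;
  lazymatch goal with
  | |- continuous (fun t => @?f t + @?g t) ?x => apply (cont_plus f g x); cont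
  | |- continuous (fun t => @?f t - @?g t) ?x => apply (cont_minus f g x); cont
  | |- continuous (fun t => @?f t * @?g t) ?x => apply (cont_mult f g x); cont
  | |- continuous (fun t => - @?f t) ?x => apply (cont_opp f x); cont
  | |- continuous (fun _ => ?c) ?x => apply (cont_const c x)
  | |- continuous (fun t => lsum _ _) _ => apply cont_lsum; cont
  | |- _ => solve [auto]
  end.

Lemma ex_RInt_cont (f : R -> R) a b : (forall x, continuous f x) -> ex_RInt f a b.
Proof. intros H. apply (ex_RInt_continuous f). intros; apply H. Qed.

(** The projection of the line onto [u, v].  Composition with it turns continuity on a closed
    interval or square into continuity everywhere, which is the form the integration
    lemmas want. *)
Definition clamp (u v x : R) : R := Rmax u (Rmin x v).

Lemma clamp_in u v x : u <= v -> u <= clamp u v x <= v.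
Proof. intros H. unfold clamp, Rmax, Rmin. repeat destruct Rle_dec; lra. Qed.

Lemma clamp_id u v x : u <= x <= v -> clamp u v x = x.
Proof. intros H. unfold clamp, Rmax, Rmin. repeat destruct Rle_dec; lra. Qed.

Lemma clamp_lipschitz u v x y : Rabs (clamp u v x - clamp u v y) <= Rabs (x - y).
Proof.
  unfold clamp, Rmax, Rmin. repeat destruct Rle_dec; split_Rabs; lra.
Qed.

Lemma clamp_continuous u v x : continuous (clamp u v) x.
Proof.
  apply filterlim_locally. intros eps. exists eps. intros y Hy.
  apply Rle_lt_trans with (2 := Hy). apply (clamp_lipschitz u v y x).
Qed.

(** At the endpoints only continuity of F is assumed: a classical solution has no second
    derivatives on the boundary. *)
Lemma RInt_derive_interior (F F' : R -> R) u v : u <= v ->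
  (forall x, u <= x <= v -> continuous F x) ->
  (forall x, u <= x <= v -> continuous F' x) ->
  (forall x, u < x < v -> is_derive F x (F' x)) ->
  is_RInt F' u v (F v - F u).
Proof.
  intros Huv CF CF' D.
  set (G := fun x => F' (clamp u v x)).
  assert (CG : forall x, continuous G x).
  { intros x. apply (continuous_comp (clamp u v) F'); [apply clamp_continuous|]. now apply CF', clamp_in. }
  assert (Dint : forall x, is_derive (fun y => RInt G u y) x (G x)).
  { intros x. apply (is_derive_RInt G _ u); [|apply CG].
    apply filter_forall. intros y. apply (RInt_correct G), ex_RInt_cont, CG. }
  destruct (MVT_gen (fun x => RInt G u x - F x) u v (fun _ => 0)) as [c [_ E]].
  - rewrite Rmin_left, Rmax_right by lra. intros x Hx.
    replace 0 with (G x - F' x) by (unfold G; rewrite clamp_id by lra; ring).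
    apply (is_derive_minus (fun y => RInt G u y) F); auto.
  - rewrite Rmin_left, Rmax_right by lra. intros x Hx.
    apply continuity_pt_filterlim. apply cont_minus; [|auto].
    apply (ex_derive_continuous (fun y => RInt G u y)). eexists. apply Dint.
  - assert (E' : RInt G u v = F v - F u).
    { rewrite (RInt_point u G) in E. unfold zero in E; simpl in E. lra. }
    rewrite <- E'. apply (is_RInt_ext G).
    + rewrite Rmin_left, Rmax_right by lra. intros x Hx. unfold G. now rewrite clamp_id by lra.
    + apply (RInt_correct G), ex_RInt_cont, CG.
Qed.

Notation hpi := (PI / 2).

Definition integral (f : R -> R) : R := RInt f (- hpi) hpi.

(** The inner product of L^2 (- pi / 2, pi / 2). *)
Definition ip (f g : R -> R) : R := integral (fun x => f x * g x).

(** Continuously differentiable on the closed interval, in the sense that f' is the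
    continuous extension of the derivative; both functions are continued to the whole line
    so that every integral of them exists without a side condition on the bounds. *)
Definition isC1 (f f' : R -> R) : Prop :=
  (forall x, continuous f x) /\ (forall x, continuous f' x) /\
  (forall x, - hpi < x < hpi -> is_derive f x (f' x)).

Lemma hpi_pos : 0 < hpi.
Proof. pose proof PI_RGT_0. lra. Qed.

Lemma integral_ext (f g : R -> R) : (forall x, - hpi < x < hpi -> f x = g x) ->
  integral f = integral g.
Proof.
  intros H. apply (RInt_ext f g). pose proof hpi_pos.
  rewrite Rmin_left, Rmax_right by lra. exact H.
Qed.

Lemma integral_plus (f g : R -> R) : (forall x, continuous f x) -> (forall x, continuous g x) ->
  integral (fun x => f x + g x) = integral f + integral g.
Proof. intros Cf Cg. apply (RInt_plus f g); now apply ex_RInt_cont. Qed.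

Lemma integral_scal (k : R) (f : R -> R) : (forall x, continuous f x) ->
  integral (fun x => k * f x) = k * integral f.
Proof. intros Cf. apply (RInt_scal f); now apply ex_RInt_cont. Qed.

Lemma integral_zero : integral (fun _ => 0) = 0.
Proof. unfold integral. rewrite RInt_const. unfold scal; simpl; unfold mult; simpl. ring. Qed.

Lemma RInt_Chasles_cont (f : R -> R) a b c : (forall x, continuous f x) ->
  RInt f a c = RInt f a b + RInt f b c.
Proof. intros Cf. symmetry. apply (RInt_Chasles f); now apply ex_RInt_cont. Qed.

Lemma integral_C1 (F F' : R -> R) : isC1 F F' -> integral F' = F hpi - F (- hpi).
Proof.
  intros [CF [CF' D]]. pose proof hpi_pos. apply is_RInt_unique.
  apply RInt_derive_interior; auto. lra.
Qed.

Lemma C1_mult (f f' g g' : R -> R) : isC1 f f' -> isC1 g g' ->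
  isC1 (fun x => f x * g x) (fun x => f' x * g x + f x * g' x).
Proof.
  intros [Cf [Cf' Df]] [Cg [Cg' Dg]]. split; [cont|split; [cont|intros]].
  apply (is_derive_mult f g); auto. intros; apply Rmult_comm.
Qed.

Lemma C1_plus (f f' g g' : R -> R) : isC1 f f' -> isC1 g g' ->
  isC1 (fun x => f x + g x) (fun x => f' x + g' x).
Proof.
  intros [Cf [Cf' Df]] [Cg [Cg' Dg]]. split; [cont|split; [cont|intros]].
  apply (is_derive_plus f g); auto.
Qed.

Lemma C1_scal k (f f' : R -> R) : isC1 f f' -> isC1 (fun x => k * f x) (fun x => k * f' x).
Proof.
  intros [Cf [Cf' Df]]. split; [cont|split; [cont|intros]].
  apply (is_derive_scal f); auto.
Qed.

Lemma C1_lsum {A} (F F' : A -> R -> R) l : (forall i, isC1 (F i) (F' i)) ->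
  isC1 (fun x => lsum (fun i => F i x) l) (fun x => lsum (fun i => F' i x) l).
Proof.
  intros H. induction l as [|i l IH].
  - split; [|split]; intros; [apply cont_const..|apply (is_derive_const 0)].
  - apply (C1_plus (F i) (F' i) _ _ (H i) IH).
Qed.

Lemma ip_sym f g : ip f g = ip g f.
Proof. apply integral_ext. intros; ring. Qed.

Lemma ip_plus_r (u f g : R -> R) : (forall x, continuous u x) -> (forall x, continuous f x) ->
  (forall x, continuous g x) -> ip u (fun x => f x + g x) = ip u f + ip u g.
Proof.
  intros Cu Cf Cg. unfold ip. rewrite <- integral_plus by (intros; cont).
  apply integral_ext. intros; ring.
Qed.

Lemma ip_scal_r (u : R -> R) k (f : R -> R) : (forall x, continuous u x) -> (forall x, continuous f x) ->
  ip u (fun x => k * f x) = k * ip u f.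
Proof.
  intros Cu Cf. unfold ip. rewrite <- integral_scal by (intros; cont).
  apply integral_ext. intros; ring.
Qed.

Lemma ip_self_nonneg (f : R -> R) : (forall x, continuous f x) -> 0 <= ip f f.
Proof.
  intros Cf. pose proof hpi_pos. apply (RInt_ge_0 (fun x => f x * f x)); [lra| |].
  - apply ex_RInt_cont. intros; cont.
  - intros. nra.
Qed.

Lemma ip_self_zero (f : R -> R) : (forall x, continuous f x) -> ip f f = 0 ->
  forall x, - hpi <= x <= hpi -> f x = 0.
Proof.
  intros Cf H0 x Hx. pose proof hpi_pos as Hp.
  destruct (Req_dec (f x) 0) as [|N]; [assumption|exfalso].
  assert (Cff : forall x, continuous (fun x => f x * f x) x) by (intros; cont).
  assert (He : 0 < Rabs (f x)) by now apply Rabs_pos_lt.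
  destruct (proj1 (filterlim_locally _ _) (Cf x) (mkposreal _ He)) as [d Hd].
  pose proof (cond_pos d).
  (* f does not vanish on [u, v], which is a nondegenerate interval even if x is an endpoint *)
  set (u := Rmax (- hpi) (x - d / 2)). set (v := Rmin hpi (x + d / 2)).
  assert (Hu : - hpi <= u <= x /\ x - d / 2 <= u).
  { unfold u, Rmax. destruct Rle_dec; lra. }
  assert (Hv : x <= v <= hpi /\ v <= x + d / 2).
  { unfold v, Rmin. destruct Rle_dec; lra. }
  assert (Huv : u < v).
  { unfold u, v, Rmax, Rmin. repeat destruct Rle_dec; lra. }
  assert (P : 0 < RInt (fun t => f t * f t) u v).
  { apply RInt_gt_0; [assumption| |intros; apply Cff].
    intros t Ht.
    assert (B : Rabs (f t - f x) < Rabs (f x)).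
    { apply Hd. change (Rabs (t - x) < d). apply Rabs_def1; lra. }
    assert (f t <> 0). { intros E. rewrite E in B. unfold Rminus in B.
      rewrite Rplus_0_l, Rabs_Ropp in B. lra. }
    nra. }
  assert (NN : forall a b, a <= b -> 0 <= RInt (fun t => f t * f t) a b).
  { intros a b Hab. apply RInt_ge_0; [assumption|now apply ex_RInt_cont|intros; nra]. }
  assert (E : ip f f = RInt (fun t => f t * f t) (- hpi) u + (RInt (fun t => f t * f t) u v
     + RInt (fun t => f t * f t) v hpi)).
  { rewrite <- RInt_Chasles_cont by assumption.
    now rewrite <- RInt_Chasles_cont by assumption. }
  pose proof (NN (- hpi) u ltac:(lra)). pose proof (NN v hpi ltac:(lra)). lra.
Qed.

(** * Wirtinger's inequality for functions vanishing at given nodes *)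

(** Picone's identity with psi (x) = cos (k (x - e)), positive on [u, v], and
    T = psi' / psi: since T' = - k^2 - T^2,
    f'^2 - k^2 f^2 = (f' - f T)^2 + (f^2 T)'.  The last term integrates to zero since at
    each endpoint either f vanishes or T does, the latter at the centre e. *)
Lemma wirtinger_cell f f' k e u v : isC1 f f' -> 0 < k -> - hpi <= u <= v -> v <= hpi ->
  - hpi < k * (u - e) -> k * (v - e) < hpi ->
  (u = e \/ f u = 0) -> (v = e \/ f v = 0) ->
  k ^ 2 * RInt (fun x => f x * f x) u v <= RInt (fun x => f' x * f' x) u v.
Proof.
  intros [Cf [Cf' Df]] Hk Huv Hv Hue Hve Bu Bv.
  set (T := fun x => - k * sin (k * (x - e)) / cos (k * (x - e))).
  assert (Hcos : forall x, u <= x <= v -> 0 < cos (k * (x - e))).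
  { intros x Hx. apply cos_gt_0; nra. }
  assert (DT : forall x, u <= x <= v -> is_derive T x (- k ^ 2 - T x * T x)).
  { intros x Hx. specialize (Hcos x Hx). unfold T. auto_derive.
    - change (k * (x + - e)) with (k * (x - e)). lra.
    - change (k * (x + - e)) with (k * (x - e)).
      pose proof (sin2_cos2 (k * (x - e))) as S. unfold Rsqr in S.
      transitivity (- k ^ 2 * (sin (k * (x - e)) * sin (k * (x - e)) + cos (k * (x - e)) * cos (k * (x - e)))
         / (cos (k * (x - e)) * cos (k * (x - e)))); [field; lra|].
      replace (sin (k * (x - e)) * sin (k * (x - e))) with (1 - cos (k * (x - e)) * cos (k * (x - e))) by lra.
      replace (- k * sin (k * (x - e)) / cos (k * (x - e)) * (- k * sin (k * (x - e)) / cos (k * (x - e))))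
        with (k ^ 2 * (sin (k * (x - e)) * sin (k * (x - e))) / (cos (k * (x - e)) * cos (k * (x - e))))
        by (field; lra).
      replace (sin (k * (x - e)) * sin (k * (x - e))) with (1 - cos (k * (x - e)) * cos (k * (x - e))) by lra.
      field. lra. }
  assert (CT : forall x, u <= x <= v -> continuous T x).
  { intros x Hx. apply (ex_derive_continuous T). eexists. now apply DT. }
  assert (Te : T e = 0).
  { unfold T. replace (k * (e - e)) with 0 by ring. rewrite sin_0. unfold Rdiv. ring. }
  assert (I : is_RInt (fun x => (f' x * f x + f x * f' x) * T x + f x * f x * (- k ^ 2 - T x * T x)) u v
     (f v * f v * T v - f u * f u * T u)).
  { apply (RInt_derive_interior (fun x => f x * f x * T x)).
    - lra.
    - intros x Hx. specialize (CT x Hx). cont.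
    - intros x Hx. specialize (CT x Hx). cont.
    - intros x Hx. apply (is_derive_mult (fun x => f x * f x) T).
      + apply (is_derive_mult f f); try (apply Df; lra). intros; apply Rmult_comm.
      + apply DT. lra.
      + intros; apply Rmult_comm. }
  replace (f v * f v * T v - f u * f u * T u) with 0 in I.
  2:{ destruct Bu as [->| ->]; destruct Bv as [->| ->]; rewrite ?Te; ring. }
  pose proof (RInt_correct _ _ _ (ex_RInt_cont (fun x => f x * f x) u v ltac:(intros; cont))) as I2.
  apply (is_RInt_scal _ _ _ (k ^ 2)) in I2.
  pose proof (RInt_correct _ _ _ (ex_RInt_cont (fun x => f' x * f' x) u v ltac:(intros; cont))) as I1.
  pose proof (is_RInt_minus _ _ _ _ _ _ (is_RInt_minus _ _ _ _ _ _ I1 I2) I) as J.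
  apply is_RInt_ge_0 in J; [|lra|].
  - unfold minus, plus, opp, scal in J; simpl in J. unfold mult in J; simpl in J. lra.
  - intros x Hx. unfold minus, plus, opp, scal; simpl. unfold mult; simpl.
    apply Rle_trans with ((f' x - f x * T x) ^ 2); [apply pow2_ge_0|right; ring].
Qed.

(** The nodes are the zeros of cos ((K + 1) (x + pi / 2)), the Neumann mode of index
    K + 1.  They cut the interval into K cells of half-length d = pi / (2 (K + 1)) and
    two end cells of length d, centred at the ends of the interval; k < K + 1 keeps
    k d < pi / 2. *)
Lemma wirtinger_nodes f f' (K : nat) k : isC1 f f' -> 0 < k < INR (S K) ->
  (forall i, (i <= K)%nat -> f (- hpi + (2 * INR i + 1) * (hpi / INR (S K))) = 0) ->
  k ^ 2 * ip f f <= ip f' f'.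
Proof.
  intros Hf Hk H0. pose proof hpi_pos as Hp.
  set (d := hpi / INR (S K)) in *.
  assert (HS : 0 < INR (S K)) by apply lt_0_INR, Nat.lt_0_succ.
  assert (Hd : 0 < d) by (apply Rdiv_lt_0_compat; lra).
  assert (HdK : INR (S K) * d = hpi) by (unfold d; field; lra).
  assert (Hkd : k * d < hpi) by nra.
  destruct Hf as [Cf [Cf' Df]].
  assert (X2 : forall a b c, RInt (fun x => f x * f x) a c
     = RInt (fun x => f x * f x) a b + RInt (fun x => f x * f x) b c).
  { intros a b c. apply RInt_Chasles_cont. intros; cont. }
  assert (X1 : forall a b c, RInt (fun x => f' x * f' x) a c
     = RInt (fun x => f' x * f' x) a b + RInt (fun x => f' x * f' x) b c).
  { intros a b c. apply RInt_Chasles_cont. intros; cont. }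
  assert (P : forall i, (i <= K)%nat ->
     k ^ 2 * RInt (fun x => f x * f x) (- hpi) (- hpi + (2 * INR i + 1) * d)
     <= RInt (fun x => f' x * f' x) (- hpi) (- hpi + (2 * INR i + 1) * d)).
  { induction i as [|i IH]; intros Hi.
    - specialize (H0 0%nat Hi). rewrite S_INR in HdK. simpl INR in *. pose proof (pos_INR K).
      apply (wirtinger_cell f f' k (- hpi)); try nra; auto.
      now split.
    - rewrite (X1 _ (- hpi + (2 * INR i + 1) * d)), (X2 _ (- hpi + (2 * INR i + 1) * d)).
      specialize (IH ltac:(lia)).
      enough (k ^ 2 * RInt (fun x => f x * f x) (- hpi + (2 * INR i + 1) * d) (- hpi + (2 * INR (S i) + 1) * d)
        <= RInt (fun x => f' x * f' x) (- hpi + (2 * INR i + 1) * d) (- hpi + (2 * INR (S i) + 1) * d)) by lra.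
      assert (HiK : INR (S i) <= INR K) by (apply le_INR; lia).
      pose proof (H0 i ltac:(lia)) as Hi0. pose proof (H0 (S i) Hi) as Hi1.
      rewrite !S_INR in *. pose proof (pos_INR i).
      apply (wirtinger_cell f f' k (- hpi + (2 * INR i + 2) * d)); try nra; auto.
      now split. }
  specialize (P K (le_n K)).
  unfold ip, integral.
  rewrite (X1 _ (- hpi + (2 * INR K + 1) * d)), (X2 _ (- hpi + (2 * INR K + 1) * d)).
  enough (k ^ 2 * RInt (fun x => f x * f x) (- hpi + (2 * INR K + 1) * d) hpi
        <= RInt (fun x => f' x * f' x) (- hpi + (2 * INR K + 1) * d) hpi) by lra.
  pose proof (H0 K (le_n K)) as HK.
  rewrite S_INR in *. pose proof (pos_INR K).
  apply (wirtinger_cell f f' k hpi); try nra; auto.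
  now split.
Qed.

(** * The one-dimensional Robin eigenfunctions *)

Definition freq (p : nat) (h : R) : R := alpha p h / PI.
Definition lambda (p : nat) (h : R) : R := freq p h ^ 2.
(** The phase p pi / 2 covers both parities at once: up to sign, this is the cosine for even
    p and the sine for odd p. *)
Definition phi (h : R) (p : nat) (x : R) : R := cos (freq p h * x + INR p * hpi).
Definition dphi (h : R) (p : nat) (x : R) : R := - freq p h * sin (freq p h * x + INR p * hpi).

Lemma freq_bounds p h : 0 <= h -> INR p <= freq p h < INR p + 1.
Proof.
  intros Hh. pose proof PI_RGT_0. pose proof (alpha_bounds p h Hh). unfold freq. split.
  - apply Rmult_le_reg_r with PI; [assumption|]. unfold Rdiv. rewrite Rmult_assoc, Rinv_l; lra.
  - apply Rmult_lt_reg_r with PI; [assumption|]. unfold Rdiv. rewrite Rmult_assoc, Rinv_l; lra.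
Qed.

Lemma freq_lt p q h : 0 <= h -> (p < q)%nat -> freq p h < freq q h.
Proof.
  intros Hh Hpq. apply Rmult_lt_compat_r; [apply Rinv_0_lt_compat, PI_RGT_0|now apply alpha_lt].
Qed.

Lemma freq_nonneg p h : 0 <= h -> 0 <= freq p h.
Proof. intros Hh. pose proof (freq_bounds p h Hh). pose proof (pos_INR p). lra. Qed.

Lemma lambda_le p q h : 0 <= h -> (p <= q)%nat -> lambda p h <= lambda q h.
Proof.
  intros Hh Hpq. apply pow_incr. split; [now apply freq_nonneg|].
  apply Nat.lt_eq_cases in Hpq as [L| ->]; [left; now apply freq_lt|lra].
Qed.

Lemma lambda_inj p q h : 0 <= h -> p <> q -> lambda p h <> lambda q h.
Proof.
  intros Hh N. pose proof (freq_nonneg p h Hh). pose proof (freq_nonneg q h Hh). unfold lambda.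
  destruct (Nat.lt_gt_cases p q) as [L _]. destruct (L N) as [G|G];
    pose proof (freq_lt _ _ h Hh G); nra.
Qed.

Lemma C1_phi h p : isC1 (phi h p) (dphi h p).
Proof.
  assert (D : forall x : R, is_derive (phi h p) x (dphi h p x)).
  { intros x. unfold phi, dphi. auto_derive; [trivial|ring]. }
  split; [|split]; intros x.
  - apply (ex_derive_continuous (phi h p)). eexists. apply D.
  - apply (ex_derive_continuous (dphi h p)). unfold dphi. auto_derive. trivial.
  - intros _. apply D.
Qed.

Lemma C1_dphi h p : isC1 (dphi h p) (fun x => - lambda p h * phi h p x).
Proof.
  split; [|split].
  - apply C1_phi.
  - pose proof (C1_phi h p) as [C _]. cont.
  - intros x _. unfold phi, dphi, lambda. auto_derive; [trivial|ring].
Qed.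

(** At x = pi / 2 the phase is p pi + theta_p / 2 and at x = - pi / 2 it is
    - theta_p / 2, so both Robin conditions say that
    (alpha_p / pi) tan (theta_p / 2) = h. *)
Lemma phi_boundary h p : 0 <= h ->
  dphi h p hpi + h * phi h p hpi = 0 /\ - dphi h p (- hpi) + h * phi h p (- hpi) = 0 /\
  phi h p (- hpi) <> 0.
Proof.
  intros Hh. pose proof PI_RGT_0 as Hpi.
  destruct (alpha_half_angle p h Hh) as [Ht E].
  set (t := (alpha p h - INR p * PI) / 2) in *.
  assert (Ef : freq p h * sin t = h * cos t).
  { unfold freq. apply Rmult_eq_reg_r with PI; [|lra].
    transitivity (alpha p h * sin t); [field; lra|rewrite E; ring]. }
  assert (E1 : freq p h * hpi + INR p * hpi = INR p * PI + t) by (unfold t, freq; field; lra).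
  assert (E2 : freq p h * - hpi + INR p * hpi = - t) by (unfold t, freq; field; lra).
  unfold phi, dphi. rewrite E1, E2, cos_neg, sin_neg.
  destruct (cos_sin_shift p t) as [-> ->].
  split; [|split].
  - replace (- freq p h * ((-1) ^ p * sin t) + h * ((-1) ^ p * cos t))
      with ((-1) ^ p * (h * cos t - freq p h * sin t)) by ring.
    rewrite Ef. ring.
  - replace (- (- freq p h * - sin t) + h * cos t) with (h * cos t - freq p h * sin t) by ring.
    rewrite Ef. ring.
  - apply Rgt_not_eq, cos_gt_0; lra.
Qed.

(** The quadratic form of the one-dimensional Robin problem, polarised. *)
Definition form (h : R) (f f' g g' : R -> R) : R :=
  ip f' g' + h * (f hpi * g hpi + f (- hpi) * g (- hpi)).

(** Weak form of the eigenvalue equation: integration by parts, the boundary terms being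
    absorbed by the Robin condition of phi_p. *)
Lemma form_phi h p f f' : 0 <= h -> isC1 f f' ->
  form h f f' (phi h p) (dphi h p) = lambda p h * ip f (phi h p).
Proof.
  intros Hh Hf.
  pose proof (integral_C1 _ _ (C1_mult _ _ _ _ Hf (C1_dphi h p))) as E.
  destruct Hf as [Cf [Cf' _]]. destruct (C1_phi h p) as [Cp [Cp' _]].
  assert (E' : integral (fun x => f' x * dphi h p x + f x * (- lambda p h * phi h p x))
     = ip f' (dphi h p) + - lambda p h * ip f (phi h p)).
  { unfold ip. rewrite <- integral_scal by cont. rewrite <- integral_plus by cont.
    apply integral_ext. intros; ring. }
  cbv beta in E. rewrite E' in E. unfold form.
  destruct (phi_boundary h p Hh) as [B1 [B2 _]].
  replace (ip f' (dphi h p)) with (f hpi * dphi h p hpi - f (- hpi) * dphi h p (- hpi)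
     + lambda p h * ip f (phi h p)) by lra.
  replace (dphi h p hpi) with (- (h * phi h p hpi)) by lra.
  replace (dphi h p (- hpi)) with (h * phi h p (- hpi)) by lra.
  ring.
Qed.

Lemma form_sym h f f' g g' : form h f f' g g' = form h g g' f f'.
Proof. unfold form. rewrite (ip_sym f' g'). ring. Qed.

Lemma phi_orthogonal h p q : 0 <= h -> p <> q -> ip (phi h p) (phi h q) = 0.
Proof.
  intros Hh N.
  pose proof (form_phi h q _ _ Hh (C1_phi h p)) as E1.
  pose proof (form_phi h p _ _ Hh (C1_phi h q)) as E2.
  rewrite form_sym, E1, (ip_sym (phi h q)) in E2.
  pose proof (lambda_inj p q h Hh N).
  apply Rmult_eq_reg_l with (lambda p h - lambda q h); lra.
Qed.

Lemma phi_norm_pos h p : 0 <= h -> 0 < ip (phi h p) (phi h p).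
Proof.
  intros Hh. destruct (C1_phi h p) as [C _].
  destruct (ip_self_nonneg _ C) as [|E]; [assumption|exfalso].
  destruct (phi_boundary h p Hh) as [_ [_ N]]. apply N.
  apply (ip_self_zero _ C (eq_sym E)). pose proof hpi_pos. lra.
Qed.

(** * Completeness of the one-dimensional eigenfunctions *)

Definition energy (h k : R) (f f' g g' : R -> R) : R := form h f f' g g' - k ^ 2 * ip f g.

Lemma energy_lin h k u u' c f f' g g' : isC1 u u' -> isC1 f f' -> isC1 g g' ->
  energy h k u u' (fun x => c * f x + g x) (fun x => c * f' x + g' x)
  = c * energy h k u u' f f' + energy h k u u' g g'.
Proof.
  intros [Cu [Cu' _]] [Cf [Cf' _]] [Cg [Cg' _]]. unfold energy, form.
  rewrite (ip_plus_r u' (fun x => c * f' x)), ip_scal_r by cont.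
  rewrite (ip_plus_r u (fun x => c * f x)), ip_scal_r by cont. ring.
Qed.

Lemma energy_lsum h k u u' (F F' : nat -> R -> R) (a : nat -> R) l :
  isC1 u u' -> (forall i, isC1 (F i) (F' i)) ->
  energy h k u u' (fun x => lsum (fun i => a i * F i x) l) (fun x => lsum (fun i => a i * F' i x) l)
  = lsum (fun i => a i * energy h k u u' (F i) (F' i)) l.
Proof.
  intros Hu HF. induction l as [|i l IH].
  - unfold energy, form, ip, lsum. simpl.
    rewrite !(integral_ext (fun x => _ * 0) (fun _ => 0)) by (intros; ring).
    rewrite integral_zero. ring.
  - rewrite lsum_cons, <- IH.
    apply (energy_lin h k u u' (a i) (F i) (F' i)); auto.
    apply (C1_lsum (fun i x => a i * F i x) (fun i x => a i * F' i x)).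
    intros. now apply C1_scal.
Qed.

Lemma ip_lsum u (F : nat -> R -> R) (a : nat -> R) l :
  (forall x, continuous u x) -> (forall i x, continuous (F i) x) ->
  ip u (fun x => lsum (fun i => a i * F i x) l) = lsum (fun i => a i * ip u (F i)) l.
Proof.
  intros Cu CF. induction l as [|i l IH].
  - unfold ip, lsum. simpl.
    rewrite (integral_ext (fun x => _ * 0) (fun _ => 0)) by (intros; ring). apply integral_zero.
  - rewrite lsum_cons, <- IH, <- ip_scal_r by cont. rewrite <- ip_plus_r by cont. reflexivity.
Qed.

(** A min-max argument without minimisation.  Choose (c, a_0, ..., a_K), not all zero, such
    that g = c f + sum a_p phi_p vanishes at the K + 1 nodes of [wirtinger_nodes].  Then
    the energy E = form - k^2 (square norm) is nonnegative at g.  By orthogonality,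
    E (g) = c^2 E (f) + sum a_p^2 (lambda_p - k^2) |phi_p|^2, where the sum is
    nonpositive and vanishes only if all a_p do; so c <> 0 and E (f) >= 0. *)
Lemma form_lower_bound h K k f f' : 0 <= h -> isC1 f f' ->
  (forall p, (p <= K)%nat -> ip f (phi h p) = 0) ->
  freq K h < k < INR (S K) -> k ^ 2 * ip f f <= form h f f' f f'.
Proof.
  intros Hh Hf Hort Hk.
  pose proof (freq_nonneg K h Hh) as HK.
  set (node := fun i => - hpi + (2 * INR i + 1) * (hpi / INR (S K))).
  (* f is the vector of index K + 1 *)
  set (V := fun i j => if Nat.eq_dec i (S K) then f (node j) else phi h i (node j)).
  destruct (dependent_family (S K) (seq 0 (S (S K))) V) as [a [[i [Hi Ha]] Hs]].
  { apply seq_NoDup. } { rewrite length_seq. lia. }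
  set (L := seq 0 (S K)).
  set (c := a (S K)).
  set (s := fun x => lsum (fun i => a i * phi h i x) L).
  set (s' := fun x => lsum (fun i => a i * dphi h i x) L).
  assert (Hs1 : isC1 s s').
  { apply (C1_lsum (fun i x => a i * phi h i x) (fun i x => a i * dphi h i x)).
    intros. apply C1_scal, C1_phi. }
  set (g := fun x => c * f x + s x). set (g' := fun x => c * f' x + s' x).
  assert (Hg : isC1 g g') by (apply (C1_plus (fun x => c * f x) (fun x => c * f' x)); [now apply C1_scal|assumption]).
  assert (Hnode : forall j, (j <= K)%nat -> g (node j) = 0).
  { intros j Hj. rewrite <- (Hs j) by lia.
    rewrite (seq_S (S K) 0), Nat.add_0_l.
    rewrite lsum_middle, app_nil_r. unfold g. f_equal.
    - unfold V. destruct Nat.eq_dec; [reflexivity|contradiction].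
    - apply lsum_ext. intros x Hx. apply in_seq in Hx. unfold V.
      destruct Nat.eq_dec; [lia|reflexivity]. }
  assert (Eg : 0 <= energy h k g g' g g').
  { pose proof (wirtinger_nodes g g' K k Hg ltac:(lra) Hnode).
    unfold energy, form. pose proof (Rle_0_sqr (g hpi)). pose proof (Rle_0_sqr (g (- hpi))).
    unfold Rsqr in *. nra. }
  destruct Hf as [Cf [Cf' Df]]. destruct Hs1 as [Cs [Cs' Ds]].
  assert (Hf : isC1 f f') by now split. assert (Hs1 : isC1 s s') by now split.
  assert (Cp : forall p x, continuous (phi h p) x) by (intros p; apply C1_phi).
  assert (Eu : forall u u', isC1 u u' -> energy h k u u' g g'
     = c * energy h k u u' f f' + lsum (fun p => a p * ((lambda p h - k ^ 2) * ip u (phi h p))) L).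
  { intros u u' Hu. unfold g, g'. rewrite energy_lin by assumption. f_equal.
    unfold s, s'. rewrite (energy_lsum h k u u' (phi h) (dphi h)); [|assumption|intros; apply C1_phi].
    apply lsum_ext. intros p _. unfold energy. rewrite form_phi by assumption. ring. }
  assert (Egf : energy h k g g' f f' = c * energy h k f f' f f').
  { transitivity (energy h k f f' g g').
    - unfold energy. now rewrite form_sym, (ip_sym g f).
    - rewrite Eu by assumption. rewrite lsum_zero; [ring|].
      intros p Hp. apply in_seq in Hp. rewrite Hort by lia. ring. }
  assert (Ip : forall p, In p L -> ip g (phi h p) = a p * ip (phi h p) (phi h p)).
  { intros p Hp. rewrite ip_sym. unfold g. rewrite (ip_plus_r _ (fun x => c * f x)), ip_scal_r by cont.
    rewrite (ip_sym _ f), Hort by (apply in_seq in Hp; lia). unfold s.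
    rewrite ip_lsum by auto. rewrite (lsum_single _ L p (seq_NoDup _ _) Hp); [ring|].
    intros q _ N. rewrite phi_orthogonal by auto. ring. }
  rewrite (Eu g g' Hg), Egf in Eg.
  rewrite (lsum_ext _ (fun p => (a p * a p) * ((lambda p h - k ^ 2) * ip (phi h p) (phi h p)))) in Eg.
  2:{ intros p Hp. rewrite Ip by assumption. ring. }
  assert (Hneg : forall p, In p L -> (lambda p h - k ^ 2) * ip (phi h p) (phi h p) < 0).
  { intros p Hp. apply in_seq in Hp. pose proof (phi_norm_pos h p Hh).
    pose proof (lambda_le p K h Hh ltac:(lia)).
    assert (lambda K h < k ^ 2) by (unfold lambda; nra). nra. }
  destruct (lsum_nonpos (fun p => (a p * a p) * ((lambda p h - k ^ 2) * ip (phi h p) (phi h p))) L) as [Hle Hz].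
  { intros p Hp. pose proof (Hneg p Hp). pose proof (Rle_0_sqr (a p)). unfold Rsqr in *. nra. }
  destruct (Req_dec c 0) as [Hc|Hc].
  - exfalso. rewrite Hc in Eg. specialize (Hz ltac:(lra)).
    rewrite seq_S in Hi. apply in_app_iff in Hi as [Hi|[<-|[]]]; [|now apply Ha].
    specialize (Hz i Hi). specialize (Hneg i Hi). cbv beta in Hz.
    apply Rmult_integral in Hz as [Hz|Hz]; [|lra].
    apply Rmult_integral in Hz as [Hz|Hz]; contradiction.
  - assert (0 <= c * c * energy h k f f' f f') by lra.
    assert (0 < c * c) by nra.
    assert (0 <= energy h k f f' f f') by nra.
    unfold energy in *. lra.
Qed.

(** If f were nonzero, the lower bound for the form at f would exceed any number; the constant k
    is the midpoint between the frequency of phi_n and n + 1, so it is at least n. *)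
Lemma phi_complete h f f' : 0 <= h -> isC1 f f' -> (forall p, ip f (phi h p) = 0) ->
  forall x, - hpi <= x <= hpi -> f x = 0.
Proof.
  intros Hh Hf Hort. pose proof Hf as [Cf _].
  apply (ip_self_zero f Cf).
  destruct (ip_self_nonneg f Cf) as [P|]; [exfalso|auto].
  set (E := form h f f' f f').
  destruct (INR_unbounded (E / ip f f + 1)) as [n Hn].
  pose proof (freq_bounds n h Hh) as Hb.
  pose proof (form_lower_bound h n ((freq n h + (INR n + 1)) / 2) f f' Hh Hf (fun p _ => Hort p)) as B.
  rewrite S_INR in B. specialize (B ltac:(lra)). fold E in B.
  assert (EE : E = E / ip f f * ip f f) by (field; lra).
  pose proof (pos_INR n).
  assert (L : E / ip f f < ((freq n h + (INR n + 1)) / 2) ^ 2).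
  { destruct (Rlt_dec (E / ip f f) 0); [nra|].
    assert (1 <= INR n) by lra. nra. }
  nra.
Qed.

(** * Integrals depending on a parameter *)

Lemma slice_x (F : R -> R -> R) x y : continuity_2d_pt F x y -> continuous (fun t => F t y) x.
Proof.
  intros H. apply filterlim_locally. intros eps. destruct (H eps) as [d Hd].
  exists d. intros t Ht. apply (Hd t y); [exact Ht|].
  rewrite Rminus_diag, Rabs_R0. apply cond_pos.
Qed.

Lemma slice_y (F : R -> R -> R) x y : continuity_2d_pt F x y -> continuous (F x) y.
Proof.
  intros H. apply filterlim_locally. intros eps. destruct (H eps) as [d Hd].
  exists d. intros t Ht. apply (Hd x t); [|exact Ht].
  rewrite Rminus_diag, Rabs_R0. apply cond_pos.
Qed.

Lemma is_RInt_RInt (f : R -> R) a b : ex_RInt f a b -> is_RInt f a b (RInt f a b).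
Proof. apply (RInt_correct f). Qed.

Lemma RInt_abs_le_open (f : R -> R) u v M : u <= v -> ex_RInt f u v ->
  (forall x, u < x < v -> Rabs (f x) <= M) -> Rabs (RInt f u v) <= (v - u) * M.
Proof.
  intros Huv Hf HM.
  pose proof (is_RInt_RInt _ _ _ Hf) as I.
  pose proof (is_RInt_const u v M) as IM.
  apply Rabs_le. split.
  - pose proof (is_RInt_ge_0 _ _ _ _ Huv (is_RInt_plus _ _ _ _ _ _ IM I)) as P.
    unfold plus, scal in P; simpl in P; unfold mult in P; simpl in P.
    specialize (P ltac:(intros x Hx; specialize (HM x Hx); apply Rabs_le_between in HM; lra)). lra.
  - pose proof (is_RInt_ge_0 _ _ _ _ Huv (is_RInt_minus _ _ _ _ _ _ IM I)) as P.
    unfold minus, plus, opp, scal in P; simpl in P; unfold mult in P; simpl in P.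
    specialize (P ltac:(intros x Hx; specialize (HM x Hx); apply Rabs_le_between in HM; lra)). lra.
Qed.

Lemma RInt_param_continuous (F : R -> R -> R) u v : u <= v ->
  (forall x y, continuity_2d_pt F x y) ->
  forall y, continuous (fun t => RInt (fun x => F x t) u v) y.
Proof.
  intros Huv CF y. apply filterlim_locally. intros eps.
  assert (He : 0 < eps / (v - u + 1)) by (apply Rdiv_lt_0_compat; [apply cond_pos|lra]).
  destruct (uniform_continuity_2d_1d F u v y (fun x _ => CF x y) (mkposreal _ He)) as [d Hd].
  exists d. cut (forall t : R, Rabs (t - y) < d ->
    Rabs (RInt (fun x => F x t) u v - RInt (fun x => F x y) u v) < eps); [trivial|].
  intros t Ht. apply Rabs_def2 in Ht.
  assert (Hex : forall s, ex_RInt (fun x => F x s) u v).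
  { intros s. apply (ex_RInt_cont (fun x => F x s)). intros x. apply slice_x, CF. }
  pose proof (RInt_minus _ _ _ _ (Hex t) (Hex y)) as E.
  unfold minus, plus, opp in E; simpl in E.
  replace (RInt (fun x => F x t) u v - RInt (fun x => F x y) u v)
    with (RInt (fun x => F x t + - F x y) u v) by exact E.
  apply Rle_lt_trans with ((v - u) * (eps / (v - u + 1))).
  - apply RInt_abs_le_open; [assumption| |].
    + apply (ex_RInt_minus (fun x => F x t) (fun x => F x y)); apply Hex.
    + intros x Hx. left. pose proof (cond_pos d). apply (Hd x y x t); try lra.
      rewrite Rminus_diag, Rabs_R0. apply cond_pos.
  - pose proof (cond_pos eps).
    apply Rmult_lt_reg_r with (v - u + 1); [lra|].
    replace ((v - u) * (eps / (v - u + 1)) * (v - u + 1)) with ((v - u) * eps) by (field; lra). nra.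
Qed.

(** Differentiation under the integral sign, with G = dF/dy assumed only in the open interval
    u < x < v: the mean value theorem and uniform continuity of G near y0 bound the
    difference quotients uniformly in x. *)
Lemma RInt_param_derive (F G : R -> R -> R) u v y0 (r : R) : u <= v -> 0 < r ->
  (forall x y, u < x < v -> Rabs (y - y0) < r -> is_derive (F x) y (G x y)) ->
  (forall x, u <= x <= v -> continuity_2d_pt G x y0) ->
  (forall y, ex_RInt (fun x => F x y) u v) ->
  is_derive (fun y => RInt (fun x => F x y) u v) y0 (RInt (fun x => G x y0) u v).
Proof.
  intros Huv Hr D CG HF. apply is_derive_Reals. intros eps Heps.
  assert (He : 0 < eps / (v - u + 1)) by (apply Rdiv_lt_0_compat; lra).
  destruct (uniform_continuity_2d_1d G u v y0 CG (mkposreal _ He)) as [d Hd].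
  pose proof (cond_pos d) as Hd0.
  assert (Hm : 0 < Rmin d r) by now apply Rmin_glb_lt.
  exists (mkposreal _ Hm). intros k Hk Hkd. simpl in Hkd.
  assert (Hkd1 : Rabs k < d) by (eapply Rlt_le_trans; [exact Hkd|apply Rmin_l]).
  assert (Hkd2 : Rabs k < r) by (eapply Rlt_le_trans; [exact Hkd|apply Rmin_r]).
  apply Rabs_def2 in Hkd1. apply Rabs_def2 in Hkd2.
  assert (HG : ex_RInt (fun x => G x y0) u v).
  { apply (ex_RInt_continuous (fun x => G x y0)). rewrite Rmin_left, Rmax_right by assumption.
    intros x Hx. now apply slice_x, CG. }
  set (q := fun x => / k * (F x (y0 + k) - F x y0) - G x y0).
  assert (Hq : is_RInt q u v (/ k * (RInt (fun x => F x (y0 + k)) u v - RInt (fun x => F x y0) u v)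
     - RInt (fun x => G x y0) u v)).
  { apply (is_RInt_minus (fun x => / k * (F x (y0 + k) - F x y0)) (fun x => G x y0));
      [|apply (is_RInt_RInt _ _ _ HG)].
    apply (is_RInt_scal (fun x => F x (y0 + k) - F x y0)).
    apply (is_RInt_minus (fun x => F x (y0 + k)) (fun x => F x y0)); apply is_RInt_RInt, HF. }
  pose proof (is_RInt_unique q u v _ Hq) as Eq.
  replace ((RInt (fun x => F x (y0 + k)) u v - RInt (fun x => F x y0) u v) / k - RInt (fun x => G x y0) u v)
    with (RInt q u v) by (rewrite Eq; apply (Rplus_eq_compat_r _ _ _ (Rmult_comm _ _))).
  apply Rle_lt_trans with ((v - u) * (eps / (v - u + 1))).
  - apply RInt_abs_le_open; [assumption|eexists; exact Hq|].
    intros x Hx. unfold q.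
    destruct (MVT_gen (F x) y0 (y0 + k) (G x)) as [c [Hc E]].
    + intros y Hy. apply D; [assumption|].
      apply Rabs_def1; unfold Rmin, Rmax in Hy; destruct Rle_dec; lra.
    + intros y Hy. apply continuity_pt_filterlim, (ex_derive_continuous (F x)).
      eexists. apply D; [assumption|].
      apply Rabs_def1; unfold Rmin, Rmax in Hy; destruct Rle_dec; lra.
    + rewrite E. replace (/ k * (G x c * (y0 + k - y0)) - G x y0) with (G x c - G x y0) by (field; lra).
      left. apply (Hd x y0 x c); try lra.
      * unfold Rmin, Rmax in Hc. destruct Rle_dec; lra.
      * rewrite Rminus_diag, Rabs_R0. assumption.
  - apply Rmult_lt_reg_r with (v - u + 1); [lra|].
    replace ((v - u) * (eps / (v - u + 1)) * (v - u + 1)) with ((v - u) * eps) by (field; lra). nra.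
Qed.

(** * Slices of functions on the square *)

(** The values of u on the closed square, continued constantly along the normals. *)
Definition ext2 (u : R * R -> R) (x y : R) : R := u (clamp (- hpi) hpi x, clamp (- hpi) hpi y).

Lemma ext2_inside u x y : - hpi <= x <= hpi -> - hpi <= y <= hpi -> ext2 u x y = u (x, y).
Proof. intros Hx Hy. unfold ext2. now rewrite !clamp_id. Qed.

Lemma ext2_continuous u : continuous_on closed_square u ->
  forall x y, continuity_2d_pt (ext2 u) x y.
Proof.
  intros Cu x y eps. pose proof hpi_pos.
  set (z := (clamp (- hpi) hpi x, clamp (- hpi) hpi y)).
  assert (Dz : closed_square z) by (split; apply clamp_in; lra).
  destruct (proj1 (filterlim_locally _ _) (Cu z Dz) eps) as [d Hd].
  exists d. intros x' y' Hx Hy. apply Hd.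
  - split; [change (Rabs (clamp (- hpi) hpi x' - clamp (- hpi) hpi x) < d)
           |change (Rabs (clamp (- hpi) hpi y' - clamp (- hpi) hpi y) < d)];
      (eapply Rle_lt_trans; [apply clamp_lipschitz|assumption]).
  - split; apply clamp_in; lra.
Qed.

Lemma square_continuous u x y : continuous_on square u -> square (x, y) ->
  continuity_2d_pt (fun x y => u (x, y)) x y.
Proof.
  intros Cu Hz eps.
  destruct (proj1 (filterlim_locally _ _) (Cu (x, y) Hz) eps) as [d Hd].
  destruct Hz as [Hx Hy]. simpl in Hx, Hy.
  assert (Hr : 0 < Rmin d (Rmin (Rmin (x + hpi) (hpi - x)) (Rmin (y + hpi) (hpi - y)))).
  { repeat apply Rmin_glb_lt; try lra. apply cond_pos. }
  exists (mkposreal _ Hr). intros x' y' Hx' Hy'. simpl in Hx', Hy'.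
  pose proof (Rmin_l d (Rmin (Rmin (x + hpi) (hpi - x)) (Rmin (y + hpi) (hpi - y)))) as M1.
  pose proof (Rmin_r d (Rmin (Rmin (x + hpi) (hpi - x)) (Rmin (y + hpi) (hpi - y)))) as M2.
  pose proof (Rmin_l (Rmin (x + hpi) (hpi - x)) (Rmin (y + hpi) (hpi - y))) as M3.
  pose proof (Rmin_r (Rmin (x + hpi) (hpi - x)) (Rmin (y + hpi) (hpi - y))) as M4.
  pose proof (Rmin_l (x + hpi) (hpi - x)). pose proof (Rmin_r (x + hpi) (hpi - x)).
  pose proof (Rmin_l (y + hpi) (hpi - y)). pose proof (Rmin_r (y + hpi) (hpi - y)).
  apply Hd.
  - split; [change (Rabs (x' - x) < d)|change (Rabs (y' - y) < d)]; lra.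
  - apply Rabs_def2 in Hx'. apply Rabs_def2 in Hy'. split; simpl; lra.
Qed.

Lemma ext2_derive_x u x y l : - hpi < x < hpi -> - hpi < y < hpi ->
  is_derive (fun t => u (t, y)) x l -> is_derive (fun t => ext2 u t y) x l.
Proof.
  intros Hx Hy. apply is_derive_ext_loc.
  assert (Hr : 0 < Rmin (x + hpi) (hpi - x)) by (apply Rmin_glb_lt; lra).
  exists (mkposreal _ Hr). cut (forall t : R, Rabs (t - x) < Rmin (x + hpi) (hpi - x) -> u (t, y) = ext2 u t y); [trivial|].
  intros t Ht.
  pose proof (Rmin_l (x + hpi) (hpi - x)). pose proof (Rmin_r (x + hpi) (hpi - x)).
  apply Rabs_def2 in Ht. rewrite ext2_inside; [reflexivity|lra|lra].
Qed.

Lemma ext2_derive_y u x y l : - hpi < x < hpi -> - hpi < y < hpi ->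
  is_derive (fun t => u (x, t)) y l -> is_derive (ext2 u x) y l.
Proof.
  intros Hx Hy. apply is_derive_ext_loc.
  assert (Hr : 0 < Rmin (y + hpi) (hpi - y)) by (apply Rmin_glb_lt; lra).
  exists (mkposreal _ Hr). cut (forall t : R, Rabs (t - y) < Rmin (y + hpi) (hpi - y) -> u (x, t) = ext2 u x t); [trivial|].
  intros t Ht.
  pose proof (Rmin_l (y + hpi) (hpi - y)). pose proof (Rmin_r (y + hpi) (hpi - y)).
  apply Rabs_def2 in Ht. rewrite ext2_inside; [reflexivity|lra|lra].
Qed.

(** Green's second identity for m and phi_p: the boundary terms cancel since both satisfy the
    Robin condition. *)
Lemma robin_second_derivative h p m m' w : 0 <= h -> isC1 m m' -> isC1 m' w ->
  m' hpi + h * m hpi = 0 -> - m' (- hpi) + h * m (- hpi) = 0 ->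
  ip (phi h p) w = - lambda p h * ip (phi h p) m.
Proof.
  intros Hh Hm Hm' B1 B2.
  destruct (phi_boundary h p Hh) as [P1 [P2 _]].
  pose proof (integral_C1 _ _ (C1_plus _ _ _ _ (C1_mult _ _ _ _ (C1_phi h p) Hm')
    (C1_scal (-1) _ _ (C1_mult _ _ _ _ (C1_dphi h p) Hm)))) as E.
  cbv beta in E.
  destruct Hm as [Cm [Cm' _]]. destruct Hm' as [_ [Cw _]].
  destruct (C1_phi h p) as [Cp [Cp' _]].
  rewrite (integral_ext _ (fun x => phi h p x * w x + lambda p h * (phi h p x * m x))) in E
    by (intros; ring).
  rewrite integral_plus, integral_scal in E by cont.
  fold (ip (phi h p) w) in E. fold (ip (phi h p) m) in E.
  replace (m' hpi) with (- (h * m hpi)) in E by lra.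
  replace (m' (- hpi)) with (h * m (- hpi)) in E by lra.
  replace (dphi h p hpi) with (- (h * phi h p hpi)) in E by lra.
  replace (dphi h p (- hpi)) with (h * phi h p (- hpi)) in E by lra.
  lra.
Qed.

(** * Coefficients of an eigenfunction *)

Definition coef (h : R) (u : R * R -> R) (p : nat) (y : R) : R :=
  ip (phi h p) (fun x => ext2 u x y).

Definition coef2 (h : R) (u : R * R -> R) (pq : nat * nat) : R :=
  ip (phi h (snd pq)) (coef h u (fst pq)).

Lemma phi_mult_continuous h p (F : R -> R -> R) x y : continuity_2d_pt F x y ->
  continuity_2d_pt (fun x y => phi h p x * F x y) x y.
Proof.
  intros CF. apply (continuity_2d_pt_mult (fun x _ => phi h p x)); [|assumption].
  apply (continuity_1d_2d_pt_comp (phi h p) (fun x _ => x)); [|apply continuity_2d_pt_id1].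
  apply continuity_pt_filterlim. destruct (C1_phi h p) as [C _]. exact (C x).
Qed.

Lemma coef_continuous h u p : continuous_on closed_square u -> forall y, continuous (coef h u p) y.
Proof.
  intros Cu y. pose proof hpi_pos.
  apply (RInt_param_continuous (fun x y => phi h p x * ext2 u x y)); [lra|].
  intros x t. now apply phi_mult_continuous, ext2_continuous.
Qed.

Lemma interior_radius (y : R) : - hpi < y < hpi ->
  exists r, 0 < r /\ forall t, Rabs (t - y) < r -> - hpi < t < hpi.
Proof.
  intros Hy. exists (Rmin (y + hpi) (hpi - y)). split; [apply Rmin_glb_lt; lra|].
  intros t Ht. pose proof (Rmin_l (y + hpi) (hpi - y)). pose proof (Rmin_r (y + hpi) (hpi - y)).
  apply Rabs_def2 in Ht. lra.
Qed.

Lemma continuity_2d_pt_swap (F : R -> R -> R) x y : continuity_2d_pt F x y ->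
  continuity_2d_pt (fun y x => F x y) y x.
Proof.
  intros H eps. destruct (H eps) as [d Hd]. exists d. intros a b Ha Hb. now apply Hd.
Qed.

(** Separation of variables.  The second derivatives of u need not extend to the boundary, so
    the x-integral of u_yy phi_p is not available directly.  Averaging the
    equation over y1 <= y <= y2 cures this: for m (x) = int_y1^y2 u (x, y) dy the second
    derivative m'' = - mu m - (u_y (x, y2) - u_y (x, y1)) is continuous up to the ends
    and m satisfies the Robin condition, so that Green's identity yields the increment of
    d = int u_y phi_p dx between y1 and y2, and hence d'. *)
Lemma coef_equation h mu u p : 0 <= h -> robin_eigenspace h mu u ->
  exists d, isC1 (coef h u p) d /\
    isC1 d (fun y => (lambda p h - mu) * coef h u p y) /\
    d hpi + h * coef h u p hpi = 0 /\ - d (- hpi) + h * coef h u p (- hpi) = 0.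
Proof.
  intros Hh [ux [uy [uxx [uxy [uyx [uyy [G1 [G2 [G3 [Cu [Cux [Cuy [Cxx [_ [_ [Cyy [Heq Hrob]]]]]]]]]]]]]]]]].
  pose proof hpi_pos as Hp.
  destruct (C1_phi h p) as [Cp [Cp' _]].
  assert (KU := ext2_continuous u Cu). assert (KX := ext2_continuous ux Cux).
  assert (KY := ext2_continuous uy Cuy).
  set (d := coef h uy p).
  assert (Cd : forall y, continuous d y) by now apply coef_continuous.
  assert (Cc : forall y, continuous (coef h u p) y) by now apply coef_continuous.
  assert (Kslice : forall (F : R -> R -> R), (forall x y, continuity_2d_pt F x y) ->
      forall y, ex_RInt (fun x => phi h p x * F x y) (- hpi) hpi).
  { intros F KF y. apply (ex_RInt_cont (fun x => phi h p x * F x y)).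
    intros x. apply (slice_x (fun x y => phi h p x * F x y)). now apply phi_mult_continuous. }
  assert (Dc : forall y, - hpi < y < hpi -> is_derive (coef h u p) y (d y)).
  { intros y Hy. destruct (interior_radius y Hy) as [r [Hr Hry]].
    apply (RInt_param_derive (fun x y => phi h p x * ext2 u x y)
             (fun x y => phi h p x * ext2 uy x y) _ _ y r); auto; try lra.
    - intros x t Hx Ht. apply (is_derive_scal (ext2 u x)).
      apply ext2_derive_y; auto. rewrite ext2_inside by (pose proof (Hry t Ht); lra).
      apply (G1 (x, t)). split; simpl; auto.
    - intros x _. now apply phi_mult_continuous. }
  assert (Inc : forall y1 y2, - hpi < y1 < y2 -> y2 < hpi ->
     d y2 - d y1 = (lambda p h - mu) * ip (phi h p) (fun x => RInt (ext2 u x) y1 y2)).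
  { intros y1 y2 H1 H2.
    set (m := fun x => RInt (ext2 u x) y1 y2).
    set (m' := fun x => RInt (ext2 ux x) y1 y2).
    assert (Cm : forall x, continuous m x).
    { apply (RInt_param_continuous (fun y x => ext2 u x y)); [lra|].
      intros. apply continuity_2d_pt_swap, KU. }
    assert (Cm' : forall x, continuous m' x).
    { apply (RInt_param_continuous (fun y x => ext2 ux x y)); [lra|].
      intros. apply continuity_2d_pt_swap, KX. }
    set (w := fun x => - mu * m x - (ext2 uy x y2 - ext2 uy x y1)).
    assert (Cs : forall y x, continuous (fun t => ext2 uy t y) x).
    { intros y x. apply slice_x, KY. }
    assert (Hm : isC1 m m').
    { split; [assumption|split; [assumption|]]. intros x Hx.
      destruct (interior_radius x Hx) as [r [Hr Hrx]].
      apply (RInt_param_derive (fun y x => ext2 u x y) (fun y x => ext2 ux x y) _ _ x r); auto; try lra.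
      - intros y t Hy Ht. specialize (Hrx t Ht). apply ext2_derive_x; try lra.
        rewrite ext2_inside by lra. apply (G1 (t, y)). split; simpl; lra.
      - intros y _. apply continuity_2d_pt_swap, KX.
      - intros t. apply (ex_RInt_cont (ext2 u t)). intros y. apply slice_y, KU. }
    assert (Hm' : isC1 m' w).
    { split; [assumption|split].
      - unfold w. intros x.
        apply (cont_minus (fun x => - mu * m x) (fun x => ext2 uy x y2 - ext2 uy x y1)).
        + apply (cont_mult (fun _ => - mu) m); [apply cont_const|apply Cm].
        + apply (cont_minus (fun x => ext2 uy x y2) (fun x => ext2 uy x y1)); apply Cs.
      - intros x Hx. destruct (interior_radius x Hx) as [r [Hr Hrx]].
        replace (w x) with (RInt (fun y => uxx (x, y)) y1 y2).
        + apply (RInt_param_derive (fun y x => ext2 ux x y) (fun y x => uxx (x, y)) _ _ x r); auto; try lra.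
          * intros y t Hy Ht. specialize (Hrx t Ht). apply ext2_derive_x; try lra.
            apply (G2 (t, y)). split; simpl; lra.
          * intros y Hy. apply (continuity_2d_pt_swap (fun x y => uxx (x, y))).
            apply square_continuous; [assumption|]. split; simpl; lra.
          * intros t. apply (ex_RInt_cont (ext2 ux t)). intros y. apply slice_y, KX.
        + apply is_RInt_unique. unfold w, m.
          apply (is_RInt_ext (fun y => - mu * ext2 u x y - uyy (x, y))).
          { rewrite Rmin_left, Rmax_right by lra. intros y Hy.
            assert (Hz : square (x, y)) by (split; simpl; lra).
            pose proof (Heq (x, y) Hz). rewrite ext2_inside by lra. lra. }
          apply (is_RInt_minus (fun y => - mu * ext2 u x y) (fun y => uyy (x, y))).
          * apply (is_RInt_scal (ext2 u x)). apply (RInt_correct (ext2 u x)).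
            apply (ex_RInt_cont (ext2 u x)). intros y. apply slice_y, KU.
          * apply (RInt_derive_interior (ext2 uy x) (fun y => uyy (x, y))); [lra| | |].
            -- intros y _. apply slice_y, KY.
            -- intros y Hy. apply (slice_y (fun x y => uyy (x, y))).
               apply square_continuous; [assumption|]. split; simpl; lra.
            -- intros y Hy. apply ext2_derive_y; try lra.
               apply (G3 (x, y)). split; simpl; lra. }
    assert (HB : forall x, x = hpi \/ x = - hpi ->
       (forall t, - hpi < t < hpi -> ux (x, t) = (if Rlt_dec 0 x then - h else h) * u (x, t)) ->
       m' x = (if Rlt_dec 0 x then - h else h) * m x).
    { intros x Hx Hb. unfold m', m.
      transitivity (RInt (fun y => (if Rlt_dec 0 x then - h else h) * ext2 u x y) y1 y2).
      - apply (RInt_ext (ext2 ux x)). rewrite Rmin_left, Rmax_right by lra.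
        intros y Hy. rewrite !ext2_inside by (destruct Hx; lra). apply Hb. lra.
      - apply (RInt_scal (ext2 u x)). apply (ex_RInt_cont (ext2 u x)).
        intros y. apply slice_y, KU. }
    pose proof (robin_second_derivative h p m m' w Hh Hm Hm') as E.
    assert (E' : ip (phi h p) w = - mu * ip (phi h p) m + -1 * (d y2 + -1 * d y1)).
    { unfold d, coef. rewrite <- !ip_scal_r by auto.
      rewrite <- ip_plus_r; [|auto|auto|intros x; apply (cont_mult (fun _ => -1)); [apply cont_const|apply Cs]].
      rewrite <- ip_scal_r; [|auto|].
      2:{ intros x. apply (cont_plus (fun x => ext2 uy x y2)); [apply Cs|].
          apply (cont_mult (fun _ => -1)); [apply cont_const|apply Cs]. }
      rewrite <- ip_plus_r; [|auto| |].
      - apply integral_ext. intros x _. unfold w. ring.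
      - intros x. apply (cont_mult (fun _ => - mu)); [apply cont_const|apply Cm].
      - intros x. apply (cont_mult (fun _ => -1)); [apply cont_const|].
        apply (cont_plus (fun x => ext2 uy x y2)); [apply Cs|].
          apply (cont_mult (fun _ => -1)); [apply cont_const|apply Cs]. }
    rewrite E' in E. clear E'.
    assert (E0 : - mu * ip (phi h p) m + -1 * (d y2 + -1 * d y1) = - lambda p h * ip (phi h p) m).
    { apply E.
      - rewrite (HB hpi); [destruct Rlt_dec; lra|now left|].
        intros t Ht. destruct (Hrob t Ht) as [R1 _]. destruct Rlt_dec; lra.
      - rewrite (HB (- hpi)); [destruct Rlt_dec; lra|now right|].
        intros t Ht. destruct (Hrob t Ht) as [_ [R2 _]]. destruct Rlt_dec; lra. }
    fold m. lra. }
  exists d. split; [|split; [|split]].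
  - now split.
  - split; [assumption|split].
    + intros y. apply (cont_mult (fun _ => lambda p h - mu)); [apply cont_const|apply Cc].
    + intros y Hy. destruct (interior_radius y Hy) as [r [Hr Hry]].
      set (y1 := (y - hpi) / 2).
      assert (Hr' : 0 < Rmin r (y - y1)) by (apply Rmin_glb_lt; unfold y1; lra).
      apply (is_derive_ext_loc (fun t => (lambda p h - mu) * ip (phi h p) (fun x => RInt (ext2 u x) y1 t) + d y1)).
      { exists (mkposreal _ Hr'). cut (forall t : R, Rabs (t - y) < Rmin r (y - y1) ->
          (lambda p h - mu) * ip (phi h p) (fun x => RInt (ext2 u x) y1 t) + d y1 = d t); [trivial|].
        intros t Ht. pose proof (Rmin_l r (y - y1)). pose proof (Rmin_r r (y - y1)).
        pose proof (Hry t ltac:(lra)). apply Rabs_def2 in Ht.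
        rewrite <- Inc; unfold y1 in *; lra. }
      replace ((lambda p h - mu) * coef h u p y) with ((lambda p h - mu) * coef h u p y + 0) by ring.
      apply (is_derive_plus (fun t => (lambda p h - mu) * ip (phi h p) (fun x => RInt (ext2 u x) y1 t)) (fun _ => d y1));
        [|apply (is_derive_const (d y1))].
      apply (is_derive_scal (fun t => ip (phi h p) (fun x => RInt (ext2 u x) y1 t))).
      apply (RInt_param_derive (fun x t => phi h p x * RInt (ext2 u x) y1 t)
               (fun x t => phi h p x * ext2 u x t) _ _ y r); auto; try lra.
      * intros x t Hx Ht. apply (is_derive_scal (fun t => RInt (ext2 u x) y1 t)).
        apply (is_derive_RInt (ext2 u x) _ y1); [|apply slice_y, KU].
        apply filter_forall. intros s. apply (RInt_correct (ext2 u x)), ex_RInt_cont.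
        intros z. apply slice_y, KU.
      * intros x _. apply phi_mult_continuous, KU.
      * intros t. apply (ex_RInt_cont (fun x => phi h p x * RInt (ext2 u x) y1 t)).
        intros x. apply (cont_mult (phi h p)); [apply Cp|].
        destruct (Rle_dec y1 t) as [L|L].
        -- apply (RInt_param_continuous (fun y x => ext2 u x y)); [lra|].
           intros. apply continuity_2d_pt_swap, KU.
        -- apply (continuous_ext (fun x => - RInt (ext2 u x) t y1)).
           { intros s. apply (opp_RInt_swap (ext2 u s)). apply ex_RInt_cont.
             intros z. apply slice_y, KU. }
           apply (cont_opp (fun x => RInt (ext2 u x) t y1)).
           apply (RInt_param_continuous (fun y x => ext2 u x y)); [lra|].
           intros. apply continuity_2d_pt_swap, KU.
  - unfold d, coef. rewrite <- ip_scal_r; [|auto|intros; apply slice_x, KU].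
    rewrite <- ip_plus_r; [|auto|intros; apply slice_x, KY|].
    + unfold ip. rewrite (integral_ext _ (fun _ => 0)); [apply integral_zero|].
      intros x Hx. rewrite !ext2_inside by lra. destruct (Hrob x Hx) as [_ [_ [R3 _]]]. rewrite R3. ring.
    + intros x. apply (cont_mult (fun _ => h)); [apply cont_const|apply slice_x, KU].
  - replace (- d (- hpi)) with (-1 * d (- hpi)) by ring.
    unfold d, coef. rewrite <- !ip_scal_r; [|auto|intros; apply slice_x; auto|auto|intros; apply slice_x; auto].
    rewrite <- ip_plus_r; [|auto| |].
    + unfold ip. rewrite (integral_ext _ (fun _ => 0)); [apply integral_zero|].
      intros x Hx. rewrite !ext2_inside by lra. destruct (Hrob x Hx) as [_ [_ [_ R4]]].
      replace (-1 * uy (x, - hpi) + h * u (x, - hpi)) with 0 by lra. ring.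
    + intros x. apply (cont_mult (fun _ => -1)); [apply cont_const|apply slice_x, KY].
    + intros x. apply (cont_mult (fun _ => h)); [apply cont_const|apply slice_x, KU].
Qed.

(** * The eigenspaces *)

Definition pair_eq_dec (a b : nat * nat) : {a = b} + {a <> b}.
Proof. decide equality; apply Nat.eq_dec. Defined.

Definition pair_value (h : R) (pq : nat * nat) : R := lambda (fst pq) h + lambda (snd pq) h.

Definition mode (h : R) (pq : nat * nat) (z : R * R) : R :=
  phi h (fst pq) (fst z) * phi h (snd pq) (snd z).

Definition mode_norm (h : R) (pq : nat * nat) : R :=
  ip (phi h (fst pq)) (phi h (fst pq)) * ip (phi h (snd pq)) (phi h (snd pq)).

Lemma phi_continuous h p x : continuous (phi h p) x.
Proof. destruct (C1_phi h p) as [C _]. apply C. Qed.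

Lemma dphi_continuous h p x : continuous (dphi h p) x.
Proof. destruct (C1_phi h p) as [_ [C _]]. apply C. Qed.

Lemma coef2_orthogonal h mu u pq : 0 <= h -> robin_eigenspace h mu u ->
  pair_value h pq <> mu -> coef2 h u pq = 0.
Proof.
  intros Hh Hu N. destruct pq as [p q].
  destruct (coef_equation h mu u p Hh Hu) as [d [Hc [Hd [B1 B2]]]].
  pose proof (robin_second_derivative h q _ _ _ Hh Hc Hd B1 B2) as E.
  destruct Hc as [Cc _].
  rewrite ip_scal_r in E; [|apply phi_continuous|assumption].
  unfold coef2, pair_value in *. simpl in *.
  apply Rmult_eq_reg_l with (lambda p h + lambda q h - mu); lra.
Qed.

(** Completeness is used twice: in y for the coefficients, which vanish since all their own
    coefficients do, and then in x for the slices of u. *)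
Lemma eigenfunction_zero h mu u : 0 <= h -> robin_eigenspace h mu u ->
  (forall pq, pair_value h pq = mu -> coef2 h u pq = 0) ->
  forall z, square z -> u z = 0.
Proof.
  intros Hh Hu H0 [x y] [Hx Hy]. simpl in Hx, Hy.
  assert (Hc : forall p, coef h u p y = 0).
  { intros p. destruct (coef_equation h mu u p Hh Hu) as [d [Hc _]].
    apply (phi_complete h _ _ Hh Hc); [|lra].
    intros q. rewrite ip_sym. change (coef2 h u (p, q) = 0).
    destruct (Req_dec (pair_value h (p, q)) mu) as [E|N]; [now apply H0|].
    now apply (coef2_orthogonal h mu). }
  destruct Hu as [ux [uy [uxx [uxy [uyx [uyy [G1 [_ [_ [Cu [Cux _]]]]]]]]]]].
  rewrite <- ext2_inside by lra.
  apply (phi_complete h (fun x => ext2 u x y) (fun x => ext2 ux x y) Hh); [| |lra].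
  - split; [|split].
    + intros t. apply slice_x. now apply ext2_continuous.
    + intros t. apply slice_x. now apply ext2_continuous.
    + intros t Ht. apply ext2_derive_x; try lra. rewrite ext2_inside by lra.
      apply (G1 (t, y)). split; simpl; lra.
  - intros p. rewrite ip_sym. exact (Hc p).
Qed.

Lemma continuous_on_lin (D : R * R -> Prop) (u v : R * R -> R) k :
  continuous_on D u -> continuous_on D v -> continuous_on D (fun z => u z + k * v z).
Proof.
  intros Cu Cv z Hz.
  apply (filterlim_comp_2 (fun z => u z) (fun z => k * v z) Rplus (Cu z Hz)
    (filterlim_comp _ _ _ v (fun t => k * t) _ _ _ (Cv z Hz) (filterlim_scal_r k (v z)))).
  apply (filterlim_plus (u z) (k * v z)).
Qed.

Lemma is_gradient_lin u ux uy v vx vy k : is_gradient u ux uy -> is_gradient v vx vy ->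
  is_gradient (fun z => u z + k * v z) (fun z => ux z + k * vx z) (fun z => uy z + k * vy z).
Proof.
  intros Gu Gv z Hz. destruct (Gu z Hz) as [U1 U2]. destruct (Gv z Hz) as [V1 V2]. split.
  - apply (is_derive_plus (fun t => u (t, snd z)) (fun t => k * v (t, snd z))); [assumption|].
    now apply (is_derive_scal (fun t => v (t, snd z))).
  - apply (is_derive_plus (fun t => u (fst z, t)) (fun t => k * v (fst z, t))); [assumption|].
    now apply (is_derive_scal (fun t => v (fst z, t))).
Qed.

Lemma eigenspace_lin h mu u v k : robin_eigenspace h mu u -> robin_eigenspace h mu v ->
  robin_eigenspace h mu (fun z => u z + k * v z).
Proof.
  intros [ux [uy [uxx [uxy [uyx [uyy [G1 [G2 [G3 [C1 [C2 [C3 [C4 [C5 [C6 [C7 [E B]]]]]]]]]]]]]]]]].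
  intros [vx [vy [vxx [vxy [vyx [vyy [G1' [G2' [G3' [C1' [C2' [C3' [C4' [C5' [C6' [C7' [E' B']]]]]]]]]]]]]]]]].
  exists (fun z => ux z + k * vx z), (fun z => uy z + k * vy z), (fun z => uxx z + k * vxx z),
    (fun z => uxy z + k * vxy z), (fun z => uyx z + k * vyx z), (fun z => uyy z + k * vyy z).
  do 3 (split; [now apply is_gradient_lin|]).
  do 7 (split; [now apply continuous_on_lin|]).
  split; [|intros t H; split; [|split; [|split]]].
  - intros z Hz. specialize (E z Hz). specialize (E' z Hz).
    transitivity (- (uxx z + uyy z) + k * - (vxx z + vyy z)); [ring|rewrite E, E'; ring].
  - destruct (B t H) as [b1 _]. destruct (B' t H) as [b1' _].
    transitivity (ux (hpi, t) + h * u (hpi, t) + k * (vx (hpi, t) + h * v (hpi, t))); [ring|rewrite b1, b1'; ring].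
  - destruct (B t H) as [_ [b1 _]]. destruct (B' t H) as [_ [b1' _]].
    transitivity (- ux (- hpi, t) + h * u (- hpi, t) + k * (- vx (- hpi, t) + h * v (- hpi, t))); [ring|rewrite b1, b1'; ring].
  - destruct (B t H) as [_ [_ [b1 _]]]. destruct (B' t H) as [_ [_ [b1' _]]].
    transitivity (uy (t, hpi) + h * u (t, hpi) + k * (vy (t, hpi) + h * v (t, hpi))); [ring|rewrite b1, b1'; ring].
  - destruct (B t H) as [_ [_ [_ b1]]]. destruct (B' t H) as [_ [_ [_ b1']]].
    transitivity (- uy (t, - hpi) + h * u (t, - hpi) + k * (- vy (t, - hpi) + h * v (t, - hpi))); [ring|rewrite b1, b1'; ring].
Qed.

Lemma continuous_product (f g : R -> R) (z : R * R) : (forall x, continuous f x) ->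
  (forall x, continuous g x) -> continuous (fun z => f (fst z) * g (snd z)) z.
Proof.
  intros Cf Cg. apply (continuous_mult (fun z : R * R => f (fst z)) (fun z => g (snd z))).
  - apply (continuous_comp fst f); [|apply Cf]. destruct z; apply continuous_fst.
  - apply (continuous_comp snd g); [|apply Cg]. destruct z; apply continuous_snd.
Qed.

Lemma is_gradient_product (f f' g g' : R -> R) :
  (forall x : R, is_derive f x (f' x)) -> (forall x : R, is_derive g x (g' x)) ->
  is_gradient (fun z => f (fst z) * g (snd z)) (fun z => f' (fst z) * g (snd z))
    (fun z => f (fst z) * g' (snd z)).
Proof.
  intros Df Dg [x y] _. simpl. split.
  - replace (f' x * g y) with (f' x * g y + f x * 0) by ring.
    apply (is_derive_mult f (fun _ => g y)); [apply Df|apply (is_derive_const (g y))|].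
    intros; apply Rmult_comm.
  - apply (is_derive_scal g). apply Dg.
Qed.

Lemma phi_derive h p (x : R) : is_derive (phi h p) x (dphi h p x).
Proof. unfold phi, dphi. auto_derive; [trivial|ring]. Qed.

Lemma dphi_derive h p (x : R) : is_derive (dphi h p) x (- lambda p h * phi h p x).
Proof. unfold phi, dphi, lambda. auto_derive; [trivial|ring]. Qed.

Lemma mode_eigenfunction h pq : 0 <= h -> robin_eigenspace h (pair_value h pq) (mode h pq).
Proof.
  intros Hh. destruct pq as [p q].
  set (ddp := fun x => - lambda p h * phi h p x). set (ddq := fun x => - lambda q h * phi h q x).
  assert (Cdd : forall r x, continuous (fun x => - lambda r h * phi h r x) x).
  { intros r x. apply (cont_mult (fun _ => - lambda r h)); [apply cont_const|apply phi_continuous]. }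
  exists (fun z => dphi h p (fst z) * phi h q (snd z)), (fun z => phi h p (fst z) * dphi h q (snd z)),
    (fun z => ddp (fst z) * phi h q (snd z)), (fun z => dphi h p (fst z) * dphi h q (snd z)),
    (fun z => dphi h p (fst z) * dphi h q (snd z)), (fun z => phi h p (fst z) * ddq (snd z)).
  assert (Cf : forall (D : R * R -> Prop) (f g : R -> R), (forall x, continuous f x) ->
     (forall x, continuous g x) -> continuous_on D (fun z => f (fst z) * g (snd z))).
  { intros D f g Cf Cg. apply continuous_on_forall. intros z _. now apply continuous_product. }
  pose proof (phi_continuous h) as K1. pose proof (dphi_continuous h) as K2.
  split; [apply (is_gradient_product (phi h p) (dphi h p) (phi h q) (dphi h q)); apply phi_derive|].
  split; [apply (is_gradient_product (dphi h p) ddp (phi h q) (dphi h q)); [apply dphi_derive|apply phi_derive]|].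
  split; [apply (is_gradient_product (phi h p) (dphi h p) (dphi h q) ddq); [apply phi_derive|apply dphi_derive]|].
  split; [apply (Cf _ (phi h p) (phi h q)); auto|].
  split; [apply (Cf _ (dphi h p) (phi h q)); auto|].
  split; [apply (Cf _ (phi h p) (dphi h q)); auto|].
  split; [apply (Cf _ ddp (phi h q)); [apply Cdd|auto]|].
  split; [apply (Cf _ (dphi h p) (dphi h q)); auto|].
  split; [apply (Cf _ (dphi h p) (dphi h q)); auto|].
  split; [apply (Cf _ (phi h p) ddq); [auto|apply Cdd]|].
  destruct (phi_boundary h p Hh) as [P1 [P2 _]]. destruct (phi_boundary h q Hh) as [Q1 [Q2 _]].
  split.
  - intros z _. unfold ddp, ddq, mode, pair_value. simpl. ring.
  - intros t _. unfold mode. simpl. repeat split.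
    + transitivity ((dphi h p hpi + h * phi h p hpi) * phi h q t); [ring|rewrite P1; ring].
    + transitivity ((- dphi h p (- hpi) + h * phi h p (- hpi)) * phi h q t); [ring|rewrite P2; ring].
    + transitivity (phi h p t * (dphi h q hpi + h * phi h q hpi)); [ring|rewrite Q1; ring].
    + transitivity (phi h p t * (- dphi h q (- hpi) + h * phi h q (- hpi))); [ring|rewrite Q2; ring].
Qed.

Lemma eigenspace_continuous h mu u : robin_eigenspace h mu u -> continuous_on closed_square u.
Proof.
  intros [ux [uy [uxx [uxy [uyx [uyy [_ [_ [_ [Cu _]]]]]]]]]]. exact Cu.
Qed.

Lemma coef2_lin h u v k pq : continuous_on closed_square u -> continuous_on closed_square v ->
  coef2 h (fun z => u z + k * v z) pq = coef2 h u pq + k * coef2 h v pq.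
Proof.
  intros Cu Cv. destruct pq as [p q]. unfold coef2. simpl.
  rewrite <- ip_scal_r; [|apply phi_continuous|now apply coef_continuous].
  rewrite <- ip_plus_r; [|apply phi_continuous|now apply coef_continuous|].
  2:{ intros x. apply (cont_mult (fun _ => k)); [apply cont_const|now apply coef_continuous]. }
  apply integral_ext. intros y _. f_equal. unfold coef.
  rewrite <- ip_scal_r; [|apply phi_continuous|intros; apply slice_x; now apply ext2_continuous].
  rewrite <- ip_plus_r; [|apply phi_continuous|intros; apply slice_x; now apply ext2_continuous|].
  - reflexivity.
  - intros x. apply (cont_mult (fun _ => k)); [apply cont_const|apply slice_x; now apply ext2_continuous].
Qed.

Lemma coef2_ext h u v pq : (forall z, square z -> u z = v z) -> coef2 h u pq = coef2 h v pq.
Proof.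
  intros E. apply integral_ext. intros y Hy. f_equal. apply integral_ext. intros x Hx.
  rewrite !ext2_inside by lra. rewrite E; [reflexivity|now split].
Qed.

Lemma coef2_mode h a b : 0 <= h ->
  coef2 h (mode h a) b = if pair_eq_dec a b then mode_norm h b else 0.
Proof.
  intros Hh. destruct a as [p q], b as [p' q'].
  assert (E : coef2 h (mode h (p, q)) (p', q') = ip (phi h p') (phi h p) * ip (phi h q') (phi h q)).
  { unfold coef2. simpl. rewrite <- ip_scal_r by (intros; apply phi_continuous).
    apply integral_ext. intros y Hy. f_equal.
    unfold coef. rewrite (Rmult_comm _ (phi h q y)).
    rewrite <- ip_scal_r by (intros; apply phi_continuous).
    apply integral_ext. intros x Hx. rewrite ext2_inside by lra. unfold mode. simpl. ring. }
  rewrite E. destruct pair_eq_dec as [D|D].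
  - injection D as -> ->. reflexivity.
  - destruct (Nat.eq_dec p p') as [->|N].
    + rewrite (phi_orthogonal h q' q); [ring|assumption|congruence].
    + rewrite (phi_orthogonal h p' p); [ring|assumption|congruence].
Qed.

Lemma mode_norm_pos h a : 0 <= h -> 0 < mode_norm h a.
Proof. intros Hh. apply Rmult_lt_0_compat; now apply phi_norm_pos. Qed.

(** Gram-Schmidt along L: each step subtracts one mode and, the modes being orthogonal, leaves
    the coefficients already cancelled at zero. *)
Lemma eigenspace_decomposition h mu (L : list (nat * nat)) u : 0 <= h -> NoDup L ->
  (forall a, In a L -> pair_value h a = mu) -> robin_eigenspace h mu u ->
  exists (C : nat * nat -> R) w, robin_eigenspace h mu w /\
    (forall z, u z = w z + lsum (fun a => C a * mode h a z) L) /\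
    forall a, In a L -> coef2 h w a = 0.
Proof.
  intros Hh Hn Hv Hu. induction L as [|a L IH].
  - exists (fun _ => 0), u. split; [assumption|split].
    + intros z. unfold lsum. simpl. ring.
    + intros a [].
  - inversion Hn as [|? ? Ha Hn']; subst.
    destruct IH as [C [w [Hw [E Z]]]]; [assumption|intros; apply Hv; now right|].
    assert (Hm : robin_eigenspace h mu (mode h a)).
    { rewrite <- (Hv a (or_introl eq_refl)). now apply mode_eigenfunction. }
    pose proof (mode_norm_pos h a Hh) as Hpos.
    set (k := coef2 h w a / mode_norm h a).
    exists (fun b => if pair_eq_dec b a then k else C b), (fun z => w z + - k * mode h a z).
    split; [now apply eigenspace_lin|split].
    + intros z. rewrite E, lsum_cons.
      destruct (pair_eq_dec a a) as [_|N]; [|contradiction].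
      rewrite (lsum_ext (fun b => (if pair_eq_dec b a then k else C b) * mode h b z) (fun b => C b * mode h b z)); [ring|].
      intros b Hb. destruct (pair_eq_dec b a) as [->|_]; [contradiction|reflexivity].
    + intros b Hb. rewrite coef2_lin; try (eapply eigenspace_continuous; eassumption).
      rewrite coef2_mode by assumption. destruct (pair_eq_dec a b) as [->|N].
      * unfold k. field. lra.
      * rewrite Z; [ring|]. destruct Hb; [contradiction|assumption].
Qed.

Lemma coef2_lsum h (c : nat -> R) (v : nat -> R * R -> R) l a :
  (forall i, continuous_on closed_square (v i)) ->
  continuous_on closed_square (fun z => lsum (fun i => c i * v i z) l) /\
  coef2 h (fun z => lsum (fun i => c i * v i z) l) a = lsum (fun i => c i * coef2 h (v i) a) l.
Proof.
  intros Cv. induction l as [|i l [IHc IH]].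
  - split.
    + apply continuous_on_forall. intros z _. apply continuous_const.
    + unfold coef2, coef, lsum, ext2. simpl.
      unfold ip. rewrite (integral_ext _ (fun _ => 0)); [apply integral_zero|].
      intros y _. rewrite (integral_ext _ (fun _ => 0)); [rewrite integral_zero; ring|].
      intros; ring.
  - assert (X : forall z, lsum (fun i => c i * v i z) (i :: l)
       = lsum (fun i => c i * v i z) l + c i * v i z).
    { intros z. rewrite lsum_cons. ring. }
    split.
    + apply (continuous_on_ext _ (fun z => lsum (fun i => c i * v i z) l + c i * v i z)).
      * intros z _. now rewrite X.
      * now apply continuous_on_lin.
    + rewrite (coef2_ext _ _ (fun z => lsum (fun i => c i * v i z) l + c i * v i z)) by (intros; apply X).
      rewrite coef2_lin, IH, lsum_cons by auto. ring.
Qed.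

Lemma map_nth_seq {A} (P : list A) d : map (fun i => nth i P d) (seq 0 (length P)) = P.
Proof.
  apply (nth_ext _ _ d d).
  - now rewrite length_map, length_seq.
  - intros n Hn. rewrite length_map, length_seq in Hn.
    rewrite (nth_indep _ d (nth 0 P d)) by now rewrite length_map, length_seq.
    rewrite (map_nth (fun i => nth i P d)), seq_nth by assumption. reflexivity.
Qed.

(** Independence: the coefficients of a vanishing combination vanish.  Spanning: the remainder left by
    [eigenspace_decomposition] has no coefficients, hence is zero on the square. *)
Lemma eigenspace_dim h mu (P : list (nat * nat)) : 0 <= h -> NoDup P ->
  (forall a, In a P <-> pair_value h a = mu) -> has_dim (robin_eigenspace h mu) (length P).
Proof.
  intros Hh Hn HP. set (a0 := (0, 0)%nat).
  exists (fun i => mode h (nth i P a0)). split; [|split].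
  - intros i Hi. rewrite <- (proj1 (HP (nth i P a0))) by now apply nth_In.
    now apply mode_eigenfunction.
  - intros c Hc j Hj.
    assert (Cm : forall i, continuous_on closed_square (mode h (nth i P a0))).
    { intros i. eapply eigenspace_continuous. now apply mode_eigenfunction. }
    pose proof (proj2 (coef2_lsum h c (fun i => mode h (nth i P a0)) (seq 0 (length P)) (nth j P a0) Cm)) as E.
    rewrite (coef2_ext _ _ (fun z => lsum (fun i : nat => c i * mode h a0 z) nil)) in E.
    2:{ intros z Hz. apply (Hc z Hz). }
    rewrite (proj2 (coef2_lsum h c (fun _ => mode h a0) nil (nth j P a0)
       (fun _ => eigenspace_continuous _ _ _ (mode_eigenfunction h a0 Hh)))) in E.
    change (0 = lsum (fun i => c i * coef2 h (mode h (nth i P a0)) (nth j P a0)) (seq 0 (length P))) in E.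
    rewrite (lsum_single _ (seq 0 (length P)) j) in E; [|apply seq_NoDup|apply in_seq; lia|].
    + rewrite coef2_mode in E by assumption.
      destruct pair_eq_dec as [_|N]; [|contradiction].
      pose proof (mode_norm_pos h (nth j P a0) Hh). symmetry in E. apply Rmult_integral in E. lra.
    + intros i Hi N. apply in_seq in Hi. rewrite coef2_mode by assumption.
      destruct pair_eq_dec as [D|_]; [|ring].
      exfalso. apply N. apply (proj1 (NoDup_nth P a0) Hn); [lia|assumption|exact D].
  - intros u Hu.
    destruct (eigenspace_decomposition h mu P u Hh Hn (fun a => proj1 (HP a)) Hu) as [C [w [Hw [E Z]]]].
    exists (fun i => C (nth i P a0)). intros z Hz.
    rewrite E, (eigenfunction_zero h mu w Hh Hw (fun a Ha => Z a (proj2 (HP a) Ha)) z Hz), Rplus_0_l.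
    unfold lin_comb, lsum. rewrite <- (map_nth_seq P a0) at 1. now rewrite map_map.
Qed.

(** * Enumeration of the spectrum *)

Lemma list_argmin {A} (val : A -> R) (P : A -> Prop) (l : list A) :
  (exists z, In z l /\ P z) ->
  exists z, P z /\ forall y, In y l -> P y -> val z <= val y.
Proof.
  induction l as [|a l IH]; intros [z [Hz Pz]]; [destruct Hz|].
  destruct (classic (exists z, In z l /\ P z)) as [E|N].
  - destruct (IH E) as [m [Pm Hm]].
    destruct (classic (P a /\ val a < val m)) as [[Pa L]|N].
    + exists a. split; [assumption|]. intros y [<-|Hy] Py; [lra|]. specialize (Hm y Hy Py). lra.
    + exists m. split; [assumption|]. intros y [<-|Hy] Py; [|now apply Hm].
      apply Rnot_lt_le. intros L. now apply N.
  - assert (z = a) as -> by (destruct Hz as [<-|Hz]; [reflexivity|exfalso; eauto]).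
    exists a. split; [assumption|]. intros y [<-|Hy] Py; [lra|exfalso; eauto].
Qed.

(** Greedy selection: the next element is one of minimal value among those not yet listed; it exists
    since sublevel sets are finite.  An element never selected would bound the values of
    infinitely many selected ones. *)
Lemma sorted_enumeration {A : Type} (val : A -> R) :
  (forall M, exists l, forall z, val z <= M -> In z l) ->
  (forall L : list A, exists z, ~ In z L) ->
  exists s : nat -> A, Injective s /\ Surjective s /\
    forall n m, (n <= m)%nat -> val (s n) <= val (s m).
Proof.
  intros Hfin Hinf.
  assert (Hmin : forall L, {z | ~ In z L /\ forall y, ~ In y L -> val z <= val y}).
  { intros L. apply constructive_indefinite_description.
    destruct (Hinf L) as [z0 Hz0]. destruct (Hfin (val z0)) as [l Hl].
    destruct (list_argmin val (fun z => ~ In z L) l) as [z [Hz Hm]].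
    { exists z0. split; [apply Hl; lra|assumption]. }
    exists z. split; [assumption|]. intros y Hy.
    destruct (Rle_dec (val y) (val z0)) as [D|D]; [now apply Hm; [apply Hl|]|].
    apply Rle_trans with (val z0); [apply Hm; [apply Hl; lra|assumption]|lra]. }
  set (pick := fun L => proj1_sig (Hmin L)).
  set (pre := fix pre n := match n with O => nil | S n => pick (pre n) :: pre n end).
  set (s := fun n => pick (pre n)).
  assert (Hpre : forall n m, (n < m)%nat -> In (s n) (pre m)).
  { intros n m. induction m as [|m IH]; intros L; [lia|].
    assert (D : n = m \/ (n < m)%nat) by lia. destruct D as [->|D]; [now left|right; auto]. }
  assert (Hpre' : forall m z, In z (pre m) -> exists n, (n < m)%nat /\ s n = z).
  { intros m z. induction m as [|m IH]; simpl; [intros []|].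
    intros [E|Hz]; [exists m; split; [lia|assumption]|].
    destruct (IH Hz) as [n [L E]]. exists n. split; [lia|assumption]. }
  assert (Hs : forall n, ~ In (s n) (pre n)) by (intros n; apply (proj2_sig (Hmin (pre n)))).
  assert (Hle : forall n y, ~ In y (pre n) -> val (s n) <= val y).
  { intros n. apply (proj2_sig (Hmin (pre n))). }
  assert (Inj : Injective s).
  { intros n m E. destruct (Nat.lt_total n m) as [L|[L|L]]; [exfalso|assumption|exfalso].
    - apply (Hs m). rewrite <- E. now apply Hpre.
    - apply (Hs n). rewrite E. now apply Hpre. }
  exists s. split; [assumption|split].
  - intros z. apply NNPP. intros N.
    destruct (Hfin (val z)) as [l Hl].
    assert (I : incl (map s (seq 0 (S (length l)))) l).
    { intros y Hy. apply in_map_iff in Hy as [n [<- _]]. apply Hl, Hle.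
      intros Hz. apply Hpre' in Hz as [k [_ E]]. apply N. now exists k. }
    apply NoDup_incl_length in I.
    + rewrite length_map, length_seq in I. lia.
    + apply Injective_map_NoDup; [assumption|apply seq_NoDup].
  - intros n m Hnm. apply Hle. intros H. apply Hpre' in H as [k [L E]].
    apply Inj in E. lia.
Qed.

Lemma pair_value_sublevel h M : 0 <= h ->
  exists l, forall a, pair_value h a <= M -> In a l.
Proof.
  intros Hh. destruct (INR_unbounded M) as [n Hn].
  exists (list_prod (seq 0 n) (seq 0 n)). intros [p q] Hv. unfold pair_value in Hv. simpl in Hv.
  assert (B : forall r, INR r <= lambda r h).
  { intros r. pose proof (freq_bounds r h Hh). unfold lambda.
    destruct r as [|r]; [simpl INR in *; nra|]. rewrite S_INR in *. pose proof (pos_INR r). nra. }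
  pose proof (B p). pose proof (B q). pose proof (pos_INR p). pose proof (pos_INR q).
  apply in_prod; apply in_seq; split; try lia; apply INR_lt; simpl; lra.
Qed.

Lemma pairs_infinite (L : list (nat * nat)) : exists a, ~ In a L.
Proof.
  exists (S (list_max (map fst L)), 0%nat). intros H.
  apply (in_map fst) in H. simpl in H.
  pose proof (proj1 (list_max_le (map fst L) (list_max (map fst L))) (le_n _)) as F.
  rewrite Forall_forall in F. specialize (F _ H). lia.
Qed.

(** The enumeration starts at 0, the spectrum at 1; hence [pred]. *)
Lemma spectrum_of_enumeration h (s : nat -> nat * nat) : 0 <= h -> Injective s -> Surjective s ->
  (forall n m, (n <= m)%nat -> pair_value h (s n) <= pair_value h (s m)) ->
  robin_spectrum h (fun k => pair_value h (s (pred k))).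
Proof.
  intros Hh Inj Sur Mon. split.
  - intros i j Hij. apply Mon. lia.
  - intros mu. destruct (pair_value_sublevel h mu Hh) as [l Hl].
    set (N := length l).
    assert (HN : forall n, pair_value h (s n) <= mu -> (n < N)%nat).
    { intros n Hn. assert (I : incl (map s (seq 0 (S n))) l).
      { intros y Hy. apply in_map_iff in Hy as [m [<- Hm]]. apply in_seq in Hm. apply Hl.
        apply Rle_trans with (2 := Hn). apply Mon. lia. }
      apply NoDup_incl_length in I.
      - rewrite length_map, length_seq in I. unfold N. lia.
      - apply Injective_map_NoDup; [assumption|apply seq_NoDup]. }
    set (ks := filter (fun k => if Req_dec_T (pair_value h (s (pred k))) mu then true else false) (seq 1 N)).
    assert (Hks : forall k, In k ks <-> (1 <= k)%nat /\ pair_value h (s (pred k)) = mu).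
    { intros k. unfold ks. rewrite filter_In, in_seq.
      destruct (Req_dec_T (pair_value h (s (pred k))) mu) as [E|E].
      - pose proof (HN (pred k) (Req_le _ _ E)). split; [tauto|]. intros [H1 _]. split; [lia|reflexivity].
      - split; [intros [_ [=]]|tauto]. }
    assert (Hnd : NoDup ks) by apply NoDup_filter, seq_NoDup.
    exists ks. split; [assumption|split; [assumption|]].
    rewrite <- (length_map (fun k => s (pred k)) ks).
    apply eigenspace_dim; [assumption| |].
    + apply NoDup_map_NoDup_ForallPairs; [|assumption].
      intros x y Hx Hy E. apply Inj in E. apply Hks in Hx. apply Hks in Hy. lia.
    + intros a. rewrite in_map_iff. split.
      * intros [k [<- Hk]]. now apply Hks.
      * intros Ha. destruct (Sur a) as [n E]. exists (S n). split; [exact E|].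
        apply Hks. simpl. rewrite E. split; [lia|assumption].
Qed.

(** Number the sorted pairs from 0.  If the value at position k exceeded v, all of A would sit at
    positions below k, which are too few; if it were less than v, the k + 1 pairs at positions up to k
    would all belong to B. *)
Lemma kth_eigenvalue h v (k : nat) (A B : list (nat * nat)) : 0 <= h ->
  NoDup A -> (k < length A)%nat -> (forall a, In a A -> pair_value h a <= v) ->
  (length B <= k)%nat -> (forall a, ~ In a B -> v <= pair_value h a) ->
  is_kth_robin_eigenvalue h (S k) v.
Proof.
  intros Hh HA LA VA LB VB.
  destruct (sorted_enumeration (pair_value h)) as [s [Inj [Sur Mon]]].
  { intros M. now apply pair_value_sublevel. } { apply pairs_infinite. }
  exists (fun k => pair_value h (s (pred k))). split; [now apply spectrum_of_enumeration|].
  simpl. apply Rle_antisym; apply Rnot_lt_le; intros L.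
  - assert (I : incl A (map s (seq 0 k))).
    { intros a Ha. destruct (Sur a) as [n <-]. apply in_map, in_seq. split; [lia|].
      apply Nat.nle_gt. intros Hn. specialize (VA _ Ha). specialize (Mon k n ltac:(lia)). lra. }
    apply (NoDup_incl_length HA) in I. rewrite length_map, length_seq in I. lia.
  - assert (I : incl (map s (seq 0 (S k))) B).
    { intros a Ha. apply in_map_iff in Ha as [n [<- Hn]]. apply in_seq in Hn.
      apply NNPP. intros N. apply VB in N. pose proof (Mon n k ltac:(lia)). lra. }
    apply NoDup_incl_length in I.
    + rewrite length_map, length_seq in I. lia.
    + apply Injective_map_NoDup; [assumption|apply seq_NoDup].
Qed.

(** * The twenty-fifth eigenvalue *)

Lemma pair_eigenvalue_value p q h : pair_eigenvalue p q h = pair_value h (p, q).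
Proof.
  unfold pair_eigenvalue, pair_value, lambda, freq. simpl. field. apply PI_neq0.
Qed.

Lemma pair_value_le h p q p' q' :
  alpha p h ^ 2 + alpha q h ^ 2 <= alpha p' h ^ 2 + alpha q' h ^ 2 ->
  pair_value h (p, q) <= pair_value h (p', q').
Proof.
  intros H. rewrite <- !pair_eigenvalue_value. unfold pair_eigenvalue.
  apply Rmult_le_compat_l; [|assumption].
  left. apply Rinv_0_lt_compat, pow_lt, PI_RGT_0.
Qed.

Lemma pair_value_sym h p q : pair_value h (p, q) = pair_value h (q, p).
Proof. apply Rplus_comm. Qed.

Lemma pair_value_mono h p q p' q' : 0 <= h -> (p <= p')%nat -> (q <= q')%nat ->
  pair_value h (p, q) <= pair_value h (p', q').
Proof. intros Hh Hp Hq. apply Rplus_le_compat; now apply lambda_le. Qed.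

Definition lowest24 : list (nat * nat) :=
  ((5, 0) :: (0, 5) :: filter (fun a => fst a + snd a <=? 6) (list_prod (seq 0 5) (seq 0 5)))%nat.

Lemma in_lowest24 p q : In (p, q) lowest24 <->
  ((p = 5 /\ q = 0) \/ (p = 0 /\ q = 5) \/ (p <= 4 /\ q <= 4 /\ p + q <= 6))%nat.
Proof.
  unfold lowest24. cbn [In]. rewrite filter_In, in_prod_iff, !in_seq, Nat.leb_le. simpl fst; simpl snd.
  split.
  - intros [E|[E|H]]; [injection E; lia|injection E; lia|lia].
  - intros [[-> ->]|[[-> ->]|H]]; [now left|right; now left|right; right; lia].
Qed.

Lemma lowest24_inside h a : 0 <= h -> In a lowest24 ->
  pair_value h a <= pair_value h (4, 3)%nat /\ pair_value h a <= pair_value h (5, 1)%nat.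
Proof.
  intros Hh. destruct a as [p q]. rewrite in_lowest24.
  pose proof (pair_value_le h 5 0 4 3 (alpha50_le_43 h Hh)) as I1.
  pose proof (pair_value_le h 4 2 5 1 (alpha42_le_51 h Hh)) as I2.
  pose proof (pair_value_le h 3 3 5 1 (alpha33_le_51 h Hh)) as I3.
  pose proof (pair_value_mono h 5 0 5 1 Hh ltac:(lia) ltac:(lia)) as I4.
  intros [[-> ->]|[[-> ->]|[Hp [Hq Hpq]]]].
  - now split.
  - rewrite (pair_value_sym h 0 5). now split.
  - split.
    + destruct (Nat.le_gt_cases q 3) as [L|L].
      * now apply pair_value_mono.
      * rewrite pair_value_sym. apply pair_value_mono; lia || assumption.
    + destruct (Nat.le_gt_cases q 2) as [L|L]; [|destruct (Nat.le_gt_cases p 2) as [L'|L']].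
      * apply Rle_trans with (2 := I2). now apply pair_value_mono.
      * apply Rle_trans with (2 := I2). rewrite pair_value_sym. now apply pair_value_mono.
      * apply Rle_trans with (2 := I3). apply pair_value_mono; lia || assumption.
Qed.

(** By symmetry let q <= p.  A pair outside dominates (4, 3) or (5, 1) entrywise, or has
    p >= 6, in which case the value of (6, 0) already exceeds that of (5, 1). *)
Lemma lowest24_outside h a : 0 <= h -> ~ In a lowest24 ->
  pair_value h (4, 3)%nat <= pair_value h a \/ pair_value h (5, 1)%nat <= pair_value h a.
Proof.
  intros Hh. destruct a as [p q]. rewrite in_lowest24. intros N.
  pose proof (pair_value_le h 5 1 6 0 (alpha51_le_60 h Hh)) as I.
  assert (W : forall p q, ((4 <= p /\ 3 <= q) \/ (5 <= p /\ 1 <= q) \/ 6 <= p)%nat ->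
    pair_value h (4, 3)%nat <= pair_value h (p, q) \/ pair_value h (5, 1)%nat <= pair_value h (p, q)).
  { intros p' q' [[H1 H2]|[[H1 H2]|H1]].
    - left. now apply pair_value_mono.
    - right. now apply pair_value_mono.
    - right. apply Rle_trans with (1 := I). apply pair_value_mono; lia || assumption. }
  destruct (Nat.le_gt_cases q p) as [L|L].
  - apply W; lia.
  - rewrite (pair_value_sym h p q). apply W; lia.
Qed.

Lemma eigenvalue25 h a : 0 <= h -> ~ In a lowest24 ->
  (forall b, In b lowest24 -> pair_value h b <= pair_value h a) ->
  (forall b, ~ In b lowest24 -> pair_value h a <= pair_value h b) ->
  is_kth_robin_eigenvalue h 25 (pair_value h a).
Proof.
  intros Hh Ha Hin Hout.
  apply (kth_eigenvalue h _ 24 (a :: lowest24) lowest24 Hh).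
  - constructor; [assumption|].
    change lowest24 with (nodup pair_eq_dec lowest24). apply NoDup_nodup.
  - change (length (a :: lowest24)) with 25%nat. lia.
  - intros b [<-|Hb]; [lra|now apply Hin].
  - change (length lowest24) with 24%nat. lia.
  - assumption.
Qed.

Theorem proposition7p4 :
  exists hs : R, 0 < hs /\
    forall h : R, 0 <= h ->
      (h <= hs -> is_kth_robin_eigenvalue h 25 (pair_eigenvalue 4 3 h)) /\
      (hs < h -> is_kth_robin_eigenvalue h 25 (pair_eigenvalue 5 1 h)).
Proof.
  destruct crossing_unique as [hs [Hhs [Hle Hgt]]].
  exists hs. split; [assumption|]. intros h Hh. rewrite !pair_eigenvalue_value. split; intros H.
  - assert (C : pair_value h (4, 3)%nat <= pair_value h (5, 1)%nat).
    { apply pair_value_le. specialize (Hle h (conj Hh H)). unfold crossing in Hle. lra. }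
    apply eigenvalue25; [assumption|rewrite in_lowest24; lia| |].
    + intros b Hb. now apply lowest24_inside.
    + intros b Hb. destruct (lowest24_outside h b Hh Hb); lra.
  - assert (C : pair_value h (5, 1)%nat <= pair_value h (4, 3)%nat).
    { apply pair_value_le. specialize (Hgt h H). unfold crossing in Hgt. lra. }
    apply eigenvalue25; [assumption|rewrite in_lowest24; lia| |].
    + intros b Hb. now apply lowest24_inside.
    + intros b Hb. destruct (lowest24_outside h b Hh Hb); lra.
Qed.
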